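(* Let $n\ge1$ and $(G,K)=(\mathrm{Sp}(2n,\mathbb C),\mathrm{GL}(n,\mathbb C))$. Suppose $\mathcal O=\mathcal O_\gamma$ is the $K$-orbit in $G/B$ indexed by the skew-symmetric $(n,n)$-clan $\gamma$. Let $z=-\iota(\gamma)\in W_n$ and $w\in\mathcal A_{\mathrm{Brion}}(\mathcal O)$. Then $$d_{\mathcal O}(w)=|\{i\in[n]:z(i)<i\}|-\ell_0(w)\qquad\text{and}\qquad \mathcal A_{\mathrm{Brion}}(\mathcal O)=\bigsqcup_{M\in \mathsf{NCSP}^{\mathrm{CI}}(\gamma)}\mathcal A(z,M).$$ Thus $\mathcal A_{\mathrm{Brion}}(\mathcal O)\subseteq\mathcal A(z)$, with equality if and only if $\gamma$ is alternating.
   Context: **Signed permutations and atoms.** $[n]=\{1,\dots,n\}$, $[\pm n]=\{\pm1,\dots,\pm n\}$. $W_n$ is the group of bijections $w:[\pm n]\to[\pm n]$ with $w(-i)=-w(i)$, a Coxeter group with simple generators $t_0=(-1,1)$, $t_i=(-i,-i-1)(i,i+1)$ ($i\in[n-1]$) and length function $\ell$. For $w\in W_n$, $-w$ is the element $i\mapsto -w(i)$, and $\ell_0(w)=|\{i\in[n]:w(i)<0\}|$. The Demazure product $\circ$ is the unique associative product on $W_n$ with $s\circ s=s$ for simple $s$ and $u\circ v=uv$ if $\ell(uv)=\ell(u)+\ell(v)$. $\mathcal I(W_n)=\{w:w=w^{-1}\}$. For $z\in\mathcal I(W_n)$, $\mathcal A(z)$ is the set of minimal-length $w\in W_n$ with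 $w^{-1}\circ w=z$, and $\mathcal A(z)^{-1}=\{w^{-1}:w\in\mathcal A(z)\}$. **Shapes.** Identify $w\in W_n$ with its one-line word $w_1\cdots w_n$. Starting from the word of $w\in\mathcal A(z)^{-1}$, repeatedly choose two consecutive letters $b\,a$ with $b>a$ and delete both, until the remaining word $\xi(w)$ is increasing. For $w\in\mathcal A(z)^{-1}$ the word $\xi(w)$ and the set $\mathrm{NDes}(w)$ of deleted pairs $(b,a)$ do not depend on the choices. $\mathrm{NNeg}(w)$ is the set of absolute values of the negative letters of $\xi(w)$. The shape $\mathrm{sh}(w)$ is the matching with blocks $\{a,b\}$ and $\{-a,-b\}$ for each $(a,-b)\in\mathrm{NDes}(w)$ with $0<a<b$, together with blocks $\{e,-e\}$ for each $e\in\mathrm{NNeg}(w)$. It is a perfect matching of $\{i\in[\pm n]:z(i)=-i\}$. For a matching $M$ set $\mathcal A(z,M)=\{w\in\mathcal A(z):\mathrm{sh}(w^{-1})=M\}$. A matching (set of disjoint 2-element subsets) in $X=-X\subset[\pm n]$ is perfect if it covers $X$, symmetric if $\{i,j\}\in M\Rightarrow\{-i,-j\}\in M$, and noncrossing if no blocks $\{i,k\},\{j,l\}$ have $i<j<k<l$. **Clans.** A $(p,q)$-clan is a sequence of $p+q$ symbols, each an integer or a sign $+$ or $-$, such that each integer that appears appears exactly twice and the number of $+$'s minus the number of $-$'s is $p-q$; two sequences are the same clan if they have the same signs in the same positions and the same pairs of positions with matching integers. $\mathrm{signs}(\gamma)$ is the subsequence of signs. A clan $(c_1,\dots,c_m)$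 is skew-symmetric if it equals $(-c_m,\dots,-c_1)$ as a clan (negation swaps $+$ and $-$). Write a skew-symmetric $(n,n)$-clan as $\gamma=(c_{-n},\dots,c_{-1},c_1,\dots,c_n)$. $\iota(\gamma)\in\mathcal I(W_n)$ is the involution having $(i,j)$ as a 2-cycle, for distinct $i,j\in[\pm n]$, iff $c_i=c_j\in\mathbb Z$. $\gamma$ is alternating if $\mathrm{signs}(\gamma)$ has no two equal adjacent entries. $\mathsf{NCSP}^{\mathrm{CI}}(\gamma)$ is the set of noncrossing symmetric perfect matchings $M$ in $\{i\in[\pm n]:c_i\in\{+,-\}\}$ such that $c_i$ and $c_j$ are opposite signs whenever $\{i,j\}\in M$. **Orbits and Brion atoms.** Let $B\supset T$ be a Borel subgroup and torus of $G$, both preserved by the involution of $G$ with fixed-point subgroup $K$; the Weyl group is $W_n$. For a $K$-orbit $\mathcal O$ in $G/B$ and a simple generator $s$ with simple root $\alpha$ and projection $\pi_\alpha:G/B\to G/P_\alpha$ ($P_\alpha$ the minimal parabolic of type $\alpha$ containing $B$), $s\cdot\mathcal O$ is the unique dense $K$-orbit in $\pi_\alpha^{-1}(\pi_\alpha(\mathcal O))$. Form the directed graph on $K$-orbits with edges $\mathcal O\xrightarrow{s}s\cdot\mathcal O$ whenever $s\cdot\mathcal O\ne\mathcal O$; an edge is doubled if $\pi_\alpha$ restricted to $\overline{\mathcal O}$ has degree two. Let $\mathcal O_{\mathrm{dense}}$ be the dense orbit. For a directed path $P=(\mathcal O\xrightarrow{s_1}\mathcal O'\xrightarrow{s_2}\cdots\xrightarrow{s_l}\mathcal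 O_{\mathrm{dense}})$ let $w(P)=s_l\cdots s_2s_1$ and let $d(P)$ be its number of doubled edges. $\mathcal A_{\mathrm{Brion}}(\mathcal O)$ is the set of all $w(P)$ for paths $P$ from $\mathcal O$ to $\mathcal O_{\mathrm{dense}}$, and $d_{\mathcal O}(w)=d(P)$ for any such $P$ with $w(P)=w$ (independent of $P$). The $K$-orbits are indexed as $\mathcal O_\gamma$ by skew-symmetric $(n,n)$-clans (standard parametrization of Matsuki–Oshima and Wyser), with $s\cdot\mathcal O_\gamma=\mathcal O_{s\cdot\gamma}$ where: (i) if $s=t_i$, $i\in[n-1]$, and $c_i,c_{i+1}$ are not both signs, or $s=t_0$ and $c_1$ is not a sign, then $s\cdot\gamma$ is the unique skew-symmetric clan with $\iota(s\cdot\gamma)=s\circ\iota(\gamma)\circ s$ and $\mathrm{signs}(s\cdot\gamma)=\mathrm{signs}(\gamma)$; (ii) if $s=t_i$, $i\in[n-1]$, and $c_i,c_{i+1}$ are both signs, then $s\cdot\gamma=\gamma$ if $c_i=c_{i+1}$, and otherwise $s\cdot\gamma$ is obtained by replacing $c_i,c_{i+1}$ by a pair of matching integers and $c_{-i-1},c_{-i}$ by another pair of matching integers, both new; (iii) if $s=t_0$ and $c_1$ is a sign (so $c_{-1}\neq c_1$), $s\cdot\gamma$ is obtained by replacing $c_{-1},c_1$ by a new pair of matching integers. The edge $\mathcal O_\gamma\xrightarrow{s}\mathcal O_{s\cdot\gamma}$ is doubled iff $s=t_i$ for some $i\in[n-1]$ with $c_{-i}=c_{i+1}\in\mathbb Z$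 and $c_{-i-1}=c_i\in\mathbb Z$. The dense orbit is indexed by $(1,2,\dots,n,n,\dots,2,1)$. *)

(* Defs.v *)
From mathcomp Require Import all_boot all_order all_fingroup all_algebra.
From mathcomp Require Import boolp classical_sets reals complex.
From mathcomp Require mpoly.

Set Implicit Arguments.
Unset Strict Implicit.
Unset Printing Implicit Defensive.

(* The ordered set [±n] = {-n < ... < -1 < 1 < ... < n} is encoded by the
   ordinals 'I_(n + n) with their usual order: the letter k in [n] is the
   ordinal n + k - 1 and the letter -k is the ordinal n - k, so that negation
   is rev_ord and [n] is the set of ordinals >= n.  Indices i : 'I_n are
   0-based, hence pos i and neg i stand for the letters i + 1 and -(i + 1). *)
Definition letter (n : nat) := 'I_(n + n).

Definition opp n (x : letter n) : letter n := rev_ord x.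
Definition pos n (i : 'I_n) : letter n := rshift n i.
Definition neg n (i : 'I_n) : letter n := opp (pos i).
Definition positive n (x : letter n) : bool := n <= x.
Definition negative n (x : letter n) : bool := x < n.

Section SignedPermutations.
Variable n : nat.
Implicit Types u v w z : {perm (letter n)}.

Definition signed w : Prop := forall x, w (opp x) = opp (w x).

(* u v as a composition of functions, x |-> u (v x); the product of {perm _}
   composes in the opposite order. *)
Definition wmul u v : {perm (letter n)} := (v * u)%g.

Definition wopp w : {perm (letter n)} := wmul (perm (@rev_ord_inj (n + n))) w.

Definition ell0 w : nat := #|[pred i : 'I_n | negative (w (pos i))]|.

(* t_0, ..., t_(n-1), where t_i with i > 0 exchanges the letters i and i + 1,
   i.e. the 0-based indices i - 1 and i. *)
Definition simple (i : 'I_n) : {perm (letter n)} :=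
  if i == 0 :> nat then tperm (neg i) (pos i)
  else wmul (tperm (neg (ord_pred i)) (neg i))
            (tperm (pos (ord_pred i)) (pos i)).

Definition wprod (s : seq 'I_n) : {perm (letter n)} :=
  foldr (fun i u => wmul (simple i) u) 1%g s.

(* Least k such that w is a product of k simple generators; for signed w it
   is less than the number of permutations of the letters. *)
Definition len w : nat :=
  find (fun k => [exists s : k.-tuple 'I_n, w == wprod s])
       (iota 0 #|{perm (letter n)}|).

(* The axioms which characterize the Demazure product on W_n; the values of
   dem outside W_n are irrelevant. *)
Record is_demazure (dem : {perm (letter n)} -> {perm (letter n)} ->
                          {perm (letter n)}) : Prop := IsDemazure {
  dem_closed : forall u v, signed u -> signed v -> signed (dem u v);
  dem_assoc : forall u v w, signed u -> signed v -> signed w ->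
    dem u (dem v w) = dem (dem u v) w;
  dem_idem : forall i : 'I_n, dem (simple i) (simple i) = simple i;
  dem_reduced : forall u v, signed u -> signed v ->
    len (wmul u v) = len u + len v -> dem u v = wmul u v }.

Definition atoms (dem : {perm (letter n)} -> {perm (letter n)} ->
                        {perm (letter n)}) z : set {perm (letter n)} :=
  fun w => [/\ signed w, dem (w^-1)%g w = z &
    forall v, signed v -> dem (v^-1)%g v = z -> len w <= len v].

Definition one_line w : seq (letter n) := [seq w (pos i) | i <- enum 'I_n].

(* The leftmost two consecutive letters b a with b > a, and the word left
   after their deletion. *)
Fixpoint first_descent (s : seq (letter n)) :
    option ((letter n * letter n) * seq (letter n)) :=
  if s is b :: s' then
    if s' is a :: s'' then
      if a < b then Some ((b, a), s'')
      else omap (fun r => (r.1, b :: r.2)) (first_descent s')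
    else None
  else None.

Fixpoint delete_descents (k : nat) (s : seq (letter n)) :
    seq (letter n * letter n) * seq (letter n) :=
  if k is k'.+1 then
    if first_descent s is Some (ba, s') then
      let r := delete_descents k' s' in (ba :: r.1, r.2)
    else ([::], s)
  else ([::], s).

(* For inverses of atoms the result does not depend on the order of the
   deletions; deleting leftmost descents first makes it a function on all
   signed permutations.  At most n deletions are possible. *)
Definition NDes w := (delete_descents n (one_line w)).1.
Definition xi w := (delete_descents n (one_line w)).2.

(* A deleted pair (p.1, p.2) = (a, -b) with 0 < a < b gives the blocks
   {a, b} and {-a, -b}. *)
Definition sh_pairs w : seq (letter n * letter n) :=
  [seq p <- NDes w | [&& positive p.1, negative p.2 & p.1 < opp p.2]].

Definition sh w : {set {set letter n}} :=
  ([set [set p.1; opp p.2] | p in sh_pairs w]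
   :|: [set [set opp p.1; p.2] | p in sh_pairs w]
   :|: [set [set opp e; e] | e in [seq x <- xi w | negative x]])%SET.

Definition atoms_sh (dem : {perm (letter n)} -> {perm (letter n)} ->
                           {perm (letter n)}) z (M : {set {set letter n}}) :
    set {perm (letter n)} :=
  fun w => atoms dem z w /\ sh (w^-1)%g = M.

End SignedPermutations.

Section Matchings.
Variable n : nat.
Implicit Type M : {set {set letter n}}.

Definition perfect_matching (X : {set letter n}) M : bool :=
  finset.partition M X && [forall A in M, #|A| == 2].

Definition symmetric_matching M : bool :=
  [forall A in M, (@opp n @: A)%SET \in M].

Definition noncrossing M : Prop :=
  forall i j k l : letter n, i < j -> j < k -> k < l ->
    ~ ([set i; k]%SET \in M /\ [set j; l]%SET \in M).

End Matchings.

(* A clan, up to renaming of its integers, is the datum of its signs and of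
   the pairs of positions carrying equal integers: the entry at x is inl y if
   it is an integer whose other occurrence is at y, and inr true, inr false
   for the signs + and -. *)
Definition symbol (n : nat) := (letter n + bool)%type.

Definition is_sign n (a : symbol n) : bool := if a is inr _ then true else false.

Record skew_clan (n : nat) := SkewClan {
  entry :> {ffun letter n -> symbol n};
  entry_mate : forall x y, entry x = inl y -> y != x /\ entry y = inl x;
  entry_balanced : #|[pred x | entry x == inr true]|
                   = #|[pred x | entry x == inr false]|;
  entry_skew : forall x, entry (opp x) =
    match entry x with inl y => inl (opp y) | inr b => inr (~~ b) end }.

Section Clans.
Variable n : nat.
Implicit Type c : skew_clan n.

Definition involution_fun c (x : letter n) : letter n :=
  if c x is inl y then y else x.

Lemma involution_fun_inj c : injective (involution_fun c).
Proof.
apply: (can_inj (g := involution_fun c)) => x; rewrite /involution_fun.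
case E: (c x) => [y|b]; last by rewrite E.
by have [_ ->] := entry_mate E.
Qed.

Definition clan_iota c : {perm (letter n)} := perm (@involution_fun_inj c).

Definition signs c : seq bool :=
  pmap (fun x => if c x is inr b then Some b else None) (enum (letter n)).

Definition alternating c : bool := sorted (fun a b => a != b) (signs c).

Definition NCSP_CI c : set {set {set letter n}} :=
  fun M => [/\ perfect_matching [set x | is_sign (c x)]%SET M,
    symmetric_matching M, noncrossing M &
    forall x y, [set x; y]%SET \in M ->
      exists b, c x = inr b /\ c y = inr (~~ b)].

(* c' is obtained from c by giving new matching integers to the positions
   exchanged by s: for t_i these are the two pairs i, i + 1 and -i - 1, -i,
   for t_0 the single pair -1, 1. *)
Definition pair_up (s : {perm (letter n)}) c c' : Prop :=
  forall x, c' x = if s x == x then c x else inl (s x).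

Definition demazure_conj dem (s : {perm (letter n)}) c c' : Prop :=
  clan_iota c' = dem s (dem (clan_iota c) s) /\ signs c' = signs c.

(* c' = t_i . c *)
Definition clan_act dem (i : 'I_n) c c' : Prop :=
  if i == 0 :> nat then
    if is_sign (c (pos i)) then pair_up (simple i) c c'
    else demazure_conj dem (simple i) c c'
  else
    if is_sign (c (pos (ord_pred i))) && is_sign (c (pos i)) then
      if c (pos (ord_pred i)) == c (pos i) then c' = c
      else pair_up (simple i) c c'
    else demazure_conj dem (simple i) c c'.

Definition clan_doubled (i : 'I_n) c : bool :=
  [&& i != 0 :> nat, c (neg (ord_pred i)) == inl (pos i)
    & c (neg i) == inl (pos (ord_pred i))].

(* (1, 2, ..., n, n, ..., 2, 1) *)
Definition dense_clan c : Prop := forall x, c x = inl (opp x).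

End Clans.

Local Open Scope ring_scope.
Local Open Scope classical_set_scope.

Section Geometry.
Variables (R : realType) (n : nat).

Definition mat := 'M[R[i]]_(n + n).

(* Matrix of the alternating form with <e_(-k), e_k> = 1 for k in [n]. *)
Definition sp_form : mat :=
  \matrix_(x, y) (if y == opp x then (if negative x then 1 else -1) else 0).

Definition Sp : set mat := [set g | g^T *m sp_form *m g = sp_form].

(* Conjugation by theta_mx is an involution of Sp with fixed-point subgroup
   K = {diag (a, d)}, isomorphic to GL(n) through a, which preserves the
   upper triangular Borel subgroup and the diagonal torus. *)
Definition theta_mx : mat :=
  \matrix_(x, y) (if y == x then (if negative x then 1 else -1) else 0).

Definition K : set mat := [set g | Sp g /\ g *m theta_mx = theta_mx *m g].

Definition B : set mat :=
  [set g | Sp g /\ forall x y : letter n, (y < x)%N -> g x y = 0].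

(* The minimal parabolic subgroup attached to t_i: block upper triangular,
   with one 2 x 2 diagonal block for each 2-cycle of t_i. *)
Definition Pmin (i : 'I_n) : set mat :=
  [set g | Sp g /\ forall x y : letter n,
     (y < x)%N -> simple i y != x -> g x y = 0].

Definition left_coset (Q : set mat) (g : mat) : set mat := [set g *m q | q in Q].

(* G / Q as a set of cosets *)
Definition quot (Q : set mat) : set (set mat) := [set left_coset Q g | g in Sp].

Definition zariski_closed (A : set mat) : Prop :=
  exists I : set (mpoly.mpoly ((n + n) * (n + n)) R[i]),
    A = [set g | forall p, I p ->
           mpoly.meval (fun k => mxvec g ord0 k) p = 0].

(* Quotient topology of the Zariski topology, for subsets of G / Q. *)
Definition closed_quot (Q : set mat) (X : set (set mat)) : Prop :=
  X `<=` quot Q /\ zariski_closed [set g | Sp g /\ X (left_coset Q g)].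

Definition closure_quot (Q : set mat) (X : set (set mat)) : set (set mat) :=
  [set F | forall Y, closed_quot Q Y -> X `<=` Y -> Y F].

(* O is a K-orbit in G / B *)
Definition is_orbit (O : set (set mat)) : Prop :=
  exists2 F, quot B F & O = [set [set k *m g | g in F] | k in K].

Definition dense_orbit_in (Y O : set (set mat)) : Prop :=
  [/\ is_orbit O, O `<=` Y & Y `<=` closure_quot B O].

(* The projection G / B -> G / P_i, gB |-> gP_i *)
Definition proj (i : 'I_n) (F : set mat) : set mat :=
  [set g *m p | g in F & p in Pmin i].

(* O' = t_i . O *)
Definition orbit_act (i : 'I_n) (O O' : set (set mat)) : Prop :=
  unique (dense_orbit_in
            [set F | quot B F /\ (proj i @` O) (proj i F)]) O'.

(* For an irreducible X (such as an orbit closure) in G / B: the restriction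
   of proj i to X has degree two, i.e. its fibres over a nonempty open subset
   of the image of X have exactly two points. *)
Definition degree_two (i : 'I_n) (X : set (set mat)) : Prop :=
  exists U : set (set mat),
    [/\ U `<=` quot (Pmin i), closed_quot (Pmin i) (quot (Pmin i) `\` U),
        (U `&` proj i @` X) !=set0 &
        forall E, U E -> (proj i @` X) E ->
          exists F1 F2, F1 <> F2 /\
            [set F | X F /\ proj i F = E] = [set F1; F2]].

Definition doubled (i : 'I_n) (O : set (set mat)) : Prop :=
  degree_two i (closure_quot B O).

(* A path is encoded by its source and the list of the pairs (label, target)
   of its edges. *)
Fixpoint path_to_dense (O : set (set mat))
    (P : seq ('I_n * set (set mat))) : Prop :=
  if P is (i, O') :: P' then
    [/\ orbit_act i O O', O' <> O & path_to_dense O' P']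
  else dense_orbit_in (quot B) O.

(* w(P) = s_l ... s_2 s_1 *)
Fixpoint path_elt (P : seq ('I_n * set (set mat))) : {perm (letter n)} :=
  if P is (i, _) :: P' then wmul (path_elt P') (simple i) else 1%g.

(* d(P) *)
Fixpoint path_doubled (O : set (set mat))
    (P : seq ('I_n * set (set mat))) : nat :=
  if P is (i, O') :: P' then (`[< doubled i O >] + path_doubled O' P')%N
  else 0%N.

Definition brion_atoms (O : set (set mat)) : set {perm (letter n)} :=
  [set w | exists2 P, path_to_dense O P & path_elt P = w].

(* The properties of the parametrization of Matsuki-Oshima and Wyser of the
   K-orbits by skew-symmetric (n, n)-clans. *)
Record clan_parametrization dem (orb : skew_clan n -> set (set mat)) : Prop :=
  ClanParametrization {
  orb_orbit : forall c, is_orbit (orb c);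
  orb_inj : injective orb;
  orb_surj : forall O, is_orbit O -> exists c, orb c = O;
  orb_act : forall i c c', clan_act dem i c c' -> orbit_act i (orb c) (orb c');
  orb_doubled : forall i c c', clan_act dem i c c' -> c' <> c ->
    (doubled i (orb c) <-> clan_doubled i c);
  orb_dense : forall c, dense_clan c -> dense_orbit_in (quot B) (orb c) }.

End Geometry.

(* Main.v *)
(** The geometry enters only through the action of the simple generators on
    clans. Along a path from a clan c to the dense one, z = - iota(c) descends
    in the weak order of signed involutions, so a path spells an atom of z; and
    an atom w of z with a chosen reduced word spells a path unless some step
    meets two equal adjacent signs.

    To each chain in the weak order from 1 to z we attach an involution f of
    the letters: f pairs the letters b, a deleted together from the word of
    w^-1 and fixes the remaining ones. A short list of inequalities relating f,
    z and the positions of the letters in that word ([blocks]) is preserved by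
    every ascent. It forces every descent met while deleting to be a pair
    {b, f b}, so deletion recovers f, and the shape of w^-1 consists of the
    sets {x, - f x} with z x = - x. Up a chain f only changes by the relabelling
    of the letters, by the merging of two fixed letters i, i + 1 (the doubled
    edges) or, when z acquires the negated letters i and i + 1, by a pair
    {i, - (i + 1)}, that is a block {i, i + 1} of the shape: this is the step
    that requires c to have opposite signs at i and i + 1. Hence w comes from a
    path iff all blocks of its shape join opposite signs. *)

(* The pairing f is carried as data because a step up a chain relabels the letters of the word of
   w^-1 and leaves their positions alone: f is then conjugated, whereas the order in which descents
   get deleted changes beyond control. Among the invariants the hinge is z x = max (f x, - x) on the
   letters x of the word: it turns an ascent of z into ascents of f and of w, and shows that the
   negated letters of the word are those with f x < - x. Chains spell atoms because all chains to z
   have the same length: each step raises a rank function of z by the same amount, and any v whose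
   product v^-1 o v is z shortens to a chain. An atom may have many reduced words, but its shape
   depends on w alone, so one chain decides the sign condition for all of them. For the formula, |{i
   in [n] : z(i) < i}| grows by one exactly at the steps t_0, which ell_0(w) counts, and at the
   mergings, which d counts. *)
Require Import Defs.
From mathcomp Require Import all_boot all_order all_fingroup all_algebra.
From mathcomp Require Import boolp classical_sets reals complex.
From mathcomp Require Import zify.
(* [opp] is shadowed by the opposite of fractions. *)
Import Defs.

Set Implicit Arguments.
Unset Strict Implicit.
Unset Printing Implicit Defensive.

(** * Simple generators *)

Section Letters.
Variable n : nat.
Implicit Types (x y : letter n) (u v w z f : {perm (letter n)}) (i : 'I_n).

Lemma oppK : involutive (@opp n). Proof. exact: rev_ordK. Qed.

Lemma oppE x : opp x = n + n - x.+1 :> nat. Proof. by []. Qed.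

Lemma opp_inj : injective (@opp n). Proof. exact: can_inj oppK. Qed.

Lemma ltn_opp x y : (opp x < opp y) = (y < x).
Proof. rewrite !oppE; have := ltn_ord x; have := ltn_ord y; lia. Qed.

Lemma ltn_oppr x y : (x < opp y) = (y < opp x).
Proof. by rewrite -ltn_opp oppK. Qed.

Lemma ltn_oppl x y : (opp x < y) = (opp y < x).
Proof. by rewrite -ltn_opp oppK. Qed.

Lemma positive_opp x : positive (opp x) = ~~ positive x.
Proof. rewrite /positive oppE; have := ltn_ord x; lia. Qed.

Lemma negativeE x : negative x = ~~ positive x.
Proof. by rewrite /negative /positive ltnNge. Qed.

Lemma positiveE x : positive x = (opp x < x).
Proof. rewrite /positive oppE; have := ltn_ord x; lia. Qed.

Lemma opp_neq x : opp x != x.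
Proof.
by apply/eqP => e; have := positive_opp x; rewrite e; case: positive.
Qed.

Lemma letter_eqE x y : (x == y :> nat) = (x == y). Proof. by []. Qed.

Lemma letter_neq_lt x y : x != y -> (x < y) || (y < x).
Proof. by rewrite -(inj_eq val_inj) neq_ltn. Qed.

Lemma ltn_neq x y : x < y -> x != y.
Proof. by move=> lt; rewrite -letter_eqE ltn_eqF. Qed.

Lemma gtn_neq x y : y < x -> x != y.
Proof. by move=> lt; rewrite eq_sym ltn_neq. Qed.

Lemma wmulE u v x : wmul u v x = u (v x).
Proof. by rewrite permM. Qed.

Lemma woppE w x : wopp w x = opp (w x).
Proof. by rewrite wmulE permE. Qed.

(** The letter just below [pos i]; for t_0 it is -1. Every generator then exchanges the neighbours
    [lo i] and [pos i] together with their negatives, and t_0 is the case where these two pairs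
    coincide. *)
Definition lo i : letter n := if i == 0 :> nat then neg i else pos (ord_pred i).

Lemma hi_lo i : pos i = (lo i).+1 :> nat.
Proof.
rewrite /lo; case: ifP => [/eqP e|/eqP i0] /=; have := ltn_ord i.
  by lia.
move=> ltin; have -> : (i + n).-1 = i.-1 + n by lia.
by rewrite modnDr modn_small; lia.
Qed.

Lemma positive_pos i : positive (pos i).
Proof. by rewrite /positive leq_addr. Qed.

Lemma opp_lo0 i : i = 0 :> nat -> opp (lo i) = pos i.
Proof. by move=> e; rewrite /lo e eqxx oppK. Qed.

Lemma positive_lo i : i != 0 :> nat -> positive (lo i).
Proof. by move=> /negPf e; rewrite /lo e positive_pos. Qed.

Lemma simpleE i x : simple i x =
  if x == lo i then pos i else if x == pos i then lo i else
  if x == opp (lo i) then opp (pos i) else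
  if x == opp (pos i) then opp (lo i) else x.
Proof.
have hl := hi_lo i.
rewrite /simple; case: ifP => i0.
  rewrite /lo i0 oppK permE /= -/(neg i).
  case: (eqVneq x (neg i)) => [//|/negPf h1]; case: (eqVneq x (pos i)) => [//|/negPf h2].
  by rewrite ?h1.
have := positive_lo (negbT i0); rewrite positiveE; move: hl.
rewrite /lo i0 -/(neg _) wmulE /neg => qp p0; have := positive_pos i.
rewrite positiveE; move: (pos (ord_pred i)) (pos i) qp p0 => p q qp p0 q0.
have ne (a b : letter n) : (a < b) || (b < a) -> (a == b) = false.
  by move=> h; apply/eqP => e; rewrite e ltnn in h.
have ne' (a b : letter n) : (a < b) || (b < a) -> a != b.
  by move=> h; rewrite ne.
have [->|xp] := eqVneq x p.
  by rewrite tpermL tpermD // ne' //; move: p0 q0; rewrite !oppE; lia.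
have [->|xq] := eqVneq x q.
  by rewrite tpermR tpermD // ne' //; move: p0 q0; rewrite !oppE; lia.
by rewrite (tpermD (x := p)) ?[p == _]eq_sym ?[q == _]eq_sym // permE.
Qed.

Lemma simple_nat i x : simple i x =
  (let h := n + i in
   if x == h.-1 :> nat then h else if x == h :> nat then h.-1 else
   if x == n + n - h :> nat then n + n - h.+1 else
   if x == n + n - h.+1 :> nat then n + n - h else x) :> nat.
Proof.
have hl : lo i = (n + i).-1 :> nat by have := hi_lo i; rewrite /=; lia.
rewrite simpleE -!(inj_eq val_inj) /= hl; have := ltn_ord i => hi.
have -> : n + n - (n + i).-1.+1 = n + n - (n + i) by lia.
by do ![case: ifP => //=] => *; lia.
Qed.

Lemma simpleK i : involutive (simple i).
Proof.
move=> x; apply/val_inj => /=; have := ltn_ord i; have := ltn_ord x.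
rewrite simple_nat /=; have := simple_nat i x; move: (simple i x) => y /=.
by do ![case: ifP => //=]; lia.
Qed.

Lemma simple_signed i : signed (simple i).
Proof.
move=> x; apply/val_inj => /=; have := ltn_ord i; have := ltn_ord x.
rewrite !simple_nat /=.
by do ![case: ifP => //=]; lia.
Qed.

Lemma simple_lo i : simple i (lo i) = pos i.
Proof. by rewrite simpleE eqxx. Qed.

Lemma simple_hi i : simple i (pos i) = lo i.
Proof. by rewrite -(simple_lo i) simpleK. Qed.

Lemma simple_gt i x : x < simple i x ->
  x = lo i /\ simple i x = pos i \/ x = opp (pos i) /\ simple i x = opp (lo i).
Proof.
have hl := hi_lo i; rewrite simpleE.
have [->|_] := eqVneq x (lo i); first by left.
have [->|_] := eqVneq x (pos i); first by rewrite hl ltnNge leqnSn.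
have [->|_] := eqVneq x (opp (lo i)); first by rewrite ltn_opp hl ltnNge leqnSn.
by have [->|_] := eqVneq x (opp (pos i)); [right|rewrite ltnn].
Qed.

Lemma simple_gtS i x : x < simple i x -> simple i x = x.+1 :> nat.
Proof.
have := ltn_ord i; have := ltn_ord x; rewrite simple_nat /=.
by do ![case: ifP => //=]; lia.
Qed.

(** Exchanged letters are neighbours, so the order of any other pair survives. Most comparisons
    below are carried through a step by this dichotomy. *)
Lemma simple_lt i x y : x < y -> simple i x < simple i y \/ y = simple i x.
Proof.
move=> xy; have [e|ne] := eqVneq y (simple i x); [by right|left].
move: ne xy; rewrite -(inj_eq val_inj) /= !simple_nat /=.
have := ltn_ord i; have := ltn_ord x; have := ltn_ord y.
by do ![case: ifP => //=]; lia.
Qed.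

Lemma simple_opp_moved i x : simple i (opp x) != opp x = (simple i x != x).
Proof. by rewrite simple_signed (inj_eq opp_inj). Qed.

Lemma simple_moved i x : simple i x != x ->
  [\/ x = lo i, x = pos i, x = opp (lo i) | x = opp (pos i)].
Proof.
rewrite simpleE.
have [->|_] := eqVneq x (lo i); first by constructor 1.
have [->|_] := eqVneq x (pos i); first by constructor 2.
have [->|_] := eqVneq x (opp (lo i)); first by constructor 3.
have [->|_] := eqVneq x (opp (pos i)); first by constructor 4.
by rewrite eqxx.
Qed.

Lemma simple_moved2 i x y : simple i x != x -> simple i y != y ->
  [\/ y = x, y = simple i x, y = opp x | y = opp (simple i x)].
Proof.
move=> /simple_moved + /simple_moved.
by do 2 case=> ->; rewrite ?simple_signed ?simple_lo ?simple_hi ?oppK;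
  by [constructor 1|constructor 2|constructor 3|constructor 4].
Qed.

Lemma simple_cross i x : positive x != positive (simple i x) ->
  simple i x = opp x.
Proof.
move=> h; apply/val_inj; move: h.
rewrite /positive /= !simple_nat /=.
have := ltn_ord i; have := ltn_ord x.
by do ![case: ifP => //=]; lia.
Qed.

Lemma simple_oppE i x : simple i x = opp x -> i = 0 :> nat.
Proof.
move=> /(congr1 val) /=; rewrite simple_nat /=.
have := ltn_ord i; have := ltn_ord x.
by do ![case: ifP => //=]; lia.
Qed.

Lemma simple0 i x : i = 0 :> nat -> simple i x != x -> simple i x = opp x.
Proof.
move=> i0 h; apply/val_inj; move: h; rewrite -(inj_eq val_inj) /= !simple_nat /=.
have := ltn_ord x.
by do ![case: ifP => //=]; lia.
Qed.

Lemma simple_ex x y : y = x.+1 :> nat -> exists i, simple i x = y.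
Proof.
move=> yx; have ltx := ltn_ord x; have lty := ltn_ord y.
have [h|h] := leqP n y.
  have hi : y - n < n by lia.
  exists (Ordinal hi); apply/val_inj; rewrite /= simple_nat /=.
  by do ![case: ifP => //=]; lia.
have hi : n - y < n by lia.
exists (Ordinal hi); apply/val_inj; rewrite /= simple_nat /=.
by do ![case: ifP => //=]; lia.
Qed.

Lemma ltn_lo_hi i : lo i < pos i.
Proof. by rewrite hi_lo. Qed.

(** The upper letters are [pos i] and [opp (lo i)]: two of weight 1, or for t_0 a single one of
    weight 2. This uniform 2 is the reason for counting twice the length. *)
Lemma simple_weight i :
  \sum_(x : letter n | simple i x < x) (1 + (simple i x == opp x)) = 2.
Proof.
have ltlh := ltn_lo_hi i.
have gt x : simple i x < x -> x = pos i \/ x = opp (lo i).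
  move=> lt; rewrite -{2}[x](simpleK i) in lt.
  by have [[_ h]|[_ h]] := simple_gt lt; rewrite simpleK in h; [left|right].
rewrite (bigD1 (pos i)) ?simple_hi //.
case: (eqVneq (lo i) (opp (pos i))) => [e|ne].
  by rewrite big1 // => x /andP[/gt[]-> //]; rewrite ?e ?oppK eqxx.
rewrite (bigD1 (opp (lo i))) ?big1.
- rewrite simple_signed simple_lo oppK.
  by rewrite [opp (pos i) == _]eq_sym (negPf ne).
- by move=> x /andP[/andP[/gt[]-> //]]; rewrite eqxx.
- rewrite simple_signed simple_lo ltn_opp ltlh.
  by apply: contra ne => /eqP<-; rewrite oppK.
Qed.

End Letters.

(** * Length *)

Section Length.
Variable n : nat.
Implicit Types (x y : letter n) (u v w z f : {perm (letter n)}) (i : 'I_n).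

Lemma signed1 : signed (1 : {perm (letter n)}).
Proof. by move=> x; rewrite !perm1. Qed.

Lemma signed_wmul u v : signed u -> signed v -> signed (wmul u v).
Proof. by move=> su sv x; rewrite !wmulE sv su. Qed.

Lemma signedV u : signed u -> signed u^-1%g.
Proof. by move=> su x; apply: (@perm_inj _ u); rewrite su !permKV. Qed.

Lemma wmulA u v w : wmul u (wmul v w) = wmul (wmul u v) w.
Proof. by rewrite /wmul mulgA. Qed.

Lemma wmul_simpleK w i : wmul (wmul w (simple i)) (simple i) = w.
Proof. by apply/permP => x; rewrite !wmulE simpleK. Qed.

Lemma simple_wmulK w i : wmul (simple i) (wmul (simple i) w) = w.
Proof. by apply/permP => x; rewrite !wmulE simpleK. Qed.

Lemma simpleV i : (simple i)^-1%g = simple i.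
Proof. by apply/permP => x; apply: (@perm_inj _ (simple i)); rewrite permKV simpleK. Qed.

Lemma wmul_inv u v : (wmul u v)^-1%g = wmul v^-1%g u^-1%g.
Proof. by rewrite /wmul invMg. Qed.

Definition asc i w : bool := w (lo i) < w (pos i).

Lemma asc_lt i w x : signed w -> asc i w -> x < simple i x -> w x < w (simple i x).
Proof.
by move=> sw a /simple_gt[[-> ->] //|[-> ->]]; rewrite !sw ltn_opp.
Qed.

Lemma asc_simple i w : asc i (wmul w (simple i)) = ~~ asc i w.
Proof.
rewrite /asc !wmulE simple_lo simple_hi -leqNgt [RHS]leq_eqVlt.
case: eqVneq => // e; have /perm_inj e' := ord_inj e; have := ltn_lo_hi i.
by rewrite e' ltnn.
Qed.

(* Twice the length: an inversion x < y is counted once together with its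
   mirror image -y < -x, and counted twice if it is its own mirror image. *)
Definition inv2 w : nat :=
  \sum_(p : letter n * letter n | (p.1 < p.2) && (w p.2 < w p.1))
    (1 + (p.2 == opp p.1)).

Lemma inv2_asc i w : signed w -> asc i w ->
  inv2 (wmul w (simple i)) = inv2 w + 2.
Proof.
move=> sw a; set s := simple i.
have sK : involutive s by exact: simpleK.
(* Applying s to both letters matches the inversions of the two sides, except for the pairs {x, s
   x}: these are inversions only after the multiplication and weigh 2 in total. *)
rewrite /inv2 (reindex_inj (h := fun p => (s p.1, s p.2))) /=; last first.
  by move=> [x y] [x' y'] [/perm_inj-> /perm_inj->].
rewrite (bigID (fun p : letter n * letter n => p.2 == s p.1)) /= addnC.
congr (_ + _); last first.
  transitivity (\sum_(x | s x < x) (1 + (s x == opp x))); last exact: simple_weight.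
  rewrite (reindex (fun x => (x, s x))) /=; last first.
    by exists fst => // -[x y]; rewrite unfold_in /= => /andP[_ /eqP->].
  apply: eq_big => [x|x _]; last first.
    by rewrite sK eq_sym (inv_eq (@oppK n)).
  rewrite !wmulE !sK eqxx andbT; case: ltnP => //= lt.
  by have := @asc_lt i w (s x) sw a; rewrite -/s sK; apply.
rewrite [RHS](bigID (fun p : letter n * letter n => p.2 == s p.1)) /=.
rewrite [X in _ = X + _]big_pred0 ?add0n; last first.
  move=> [x y] /=; case: (eqVneq y (s x)) => [->|]; rewrite ?andbF // andbT.
  case: ltnP => //= lt; apply/negbTE; rewrite -leqNgt ltnW //.
  exact: asc_lt.
apply: eq_big => [[x y]|[x y] _] /=.
  rewrite !wmulE !sK; case: eqVneq => [|ne]; rewrite ?andbF //= !andbT.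
  congr andb; apply/idP/idP => lt.
    have [|e] := simple_lt i lt; first by rewrite -/s !sK.
    by move: ne; rewrite -(sK y) e -/s sK eqxx.
  by have [|e] := simple_lt i lt => //; rewrite e eqxx in ne.
by rewrite -simple_signed (inj_eq perm_inj).
Qed.

Lemma inv2_desc i w : signed w -> ~~ asc i w ->
  inv2 w = inv2 (wmul w (simple i)) + 2.
Proof.
move=> sw; rewrite -asc_simple => /inv2_asc <-; last first.
  exact: signed_wmul sw (simple_signed i).
by rewrite wmul_simpleK.
Qed.

Lemma inv2V w : signed w -> inv2 w^-1%g = inv2 w.
Proof.
move=> sw; rewrite /inv2 (reindex_inj (h := fun p => (w p.2, w p.1))) /=; last first.
  by move=> [x y] [x' y'] [/perm_inj-> /perm_inj->].
apply: eq_big => [[x y]|[x y] _] /=; rewrite ?permK 1?andbC //.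
by rewrite -sw (inj_eq perm_inj) eq_sym (inv_eq (@oppK n)).
Qed.

Lemma inv2_1 : inv2 1%g = 0.
Proof. by apply: big_pred0 => -[x y]; rewrite !perm1 /= -[RHS](ltnn x); lia. Qed.

Lemma increasing_perm1 m (w : {perm 'I_m}) :
  (forall x y : 'I_m, y = x.+1 :> nat -> w x < w y) -> w = 1%g.
Proof.
move=> inc.
have ge (x : 'I_m) : x <= w x.
  case: x; elim=> [//|k IH] lt /=.
  have := inc (Ordinal (ltnW lt)) (Ordinal lt) erefl.
  exact: leq_ltn_trans (IH (ltnW lt)).
have le k : k < m -> forall x : 'I_m, x + k = m.-1 -> w x + k <= m.-1.
  elim: k => [|k IH] lt x e; first by rewrite addn0; have := ltn_ord (w x); lia.
  have lx : x.+1 < m by lia.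
  have := inc x (Ordinal lx) erefl; have /= := IH (ltnW lt) (Ordinal lx); lia.
apply/permP => x; apply/val_inj; rewrite perm1 /=.
have := ge x; have lt := ltn_ord x.
have /le/(_ x) : m.-1 - x < m by lia.
lia.
Qed.

Lemma asc_all1 w : signed w -> (forall i, asc i w) -> w = 1%g.
Proof.
move=> sw a; apply: increasing_perm1 => x y e.
have [i h] := simple_ex e; rewrite -h; apply: asc_lt => //.
by rewrite h e.
Qed.

Lemma desc_ex w : signed w -> w <> 1%g -> exists i, ~~ asc i w.
Proof.
move=> sw w1; have [h|/forallPn[i h]] := boolP [forall i, asc i w]; last by exists i.
by case: w1; apply: asc_all1 => // i; apply: (forallP h).
Qed.

Lemma signed_ind (P : {perm (letter n)} -> Prop) : P 1%g ->
  (forall i w, signed w -> asc i w -> P w -> P (wmul w (simple i))) ->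
  forall w, signed w -> P w.
Proof.
move=> P1 PS w; have [m] := ubnP (inv2 w); elim: m w => // m IH w lt sw.
have [->//|/eqP w1] := eqVneq w 1%g; have [i d] := desc_ex sw w1.
rewrite -(wmul_simpleK w i); have sws := signed_wmul sw (simple_signed i).
apply: PS => //; first by rewrite asc_simple.
by apply: IH => //; have := inv2_desc sw d; lia.
Qed.

Lemma wprod_cat (s t : seq 'I_n) : wprod (s ++ t) = wmul (wprod s) (wprod t).
Proof. by elim: s => [|i s IH] /=; rewrite ?IH ?wmulA // /wmul mulg1. Qed.

Lemma signed_wprod (s : seq 'I_n) : signed (wprod s).
Proof.
elim: s => [|i s IH]; first exact: signed1.
exact: signed_wmul (simple_signed i) IH.
Qed.

Lemma wprod_rcons s i : wprod (rcons s i) = wmul (wprod s) (simple i).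
Proof. by rewrite -cats1 wprod_cat /= /wmul mul1g. Qed.

Lemma inv2_wprod s : inv2 (wprod s) <= (size s).*2.
Proof.
elim/last_ind: s => [|s i IH]; first by rewrite inv2_1.
rewrite wprod_rcons size_rcons; have sw := signed_wprod s.
case: (boolP (asc i (wprod s))) => [a|d]; first by rewrite inv2_asc //; lia.
by have := inv2_desc sw d; lia.
Qed.

Lemma wprod_ex w : signed w -> exists s, wprod s = w /\ inv2 w = (size s).*2.
Proof.
move: w; apply: signed_ind => [|i w sw a [s [es e]]]; first by exists [::]; rewrite inv2_1.
exists (rcons s i); rewrite wprod_rcons size_rcons es inv2_asc //.
by split => //; lia.
Qed.

(** [len] searches only below the number of all permutations. Climbing from 1 to w by ascents meets
    elements with distinct values of [inv2], one more than the length of w. *)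
Lemma inv2_bound w : signed w -> inv2 w < #|{perm (letter n)}|.*2.
Proof.
move=> sw.
suff [s [us _ ss]] : exists s : seq {perm letter n},
    [/\ uniq s, forall u, u \in s -> inv2 u <= inv2 w & inv2 w + 2 = (size s).*2].
  apply: (@leq_trans (size s).*2); first lia.
  by rewrite leq_double -(card_uniqP us) max_card.
move: w sw; apply: signed_ind => [|i w sw a [s [us les es]]].
  by exists [:: 1%g]; rewrite inv2_1; split => // u; rewrite inE => /eqP->; rewrite inv2_1.
have e := inv2_asc sw a; exists (wmul w (simple i) :: s); split.
- by rewrite /= us andbT; apply/negP => /les; lia.
- by move=> u; rewrite inE => /orP[/eqP->//|/les]; lia.
- by rewrite e /=; lia.
Qed.

Lemma lenE w : signed w -> (len w).*2 = inv2 w.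
Proof.
move=> sw; rewrite /len; set N := #|_|; set a := fun k => _.
have [s [es ss]] := wprod_ex sw.
have ltN : size s < N by have := inv2_bound sw; rewrite -/N; lia.
have hk : a (size s) by apply/existsP; exists (in_tuple s); rewrite es.
have le : find a (iota 0 N) <= size s.
  rewrite leqNgt; apply/negP => /(before_find 0).
  by rewrite nth_iota // add0n hk.
apply/eqP; rewrite eqn_leq ss leq_double le /=.
have lt : find a (iota 0 N) < N by lia.
have : has a (iota 0 N) by rewrite has_find size_iota.
move=> /(nth_find 0); rewrite nth_iota // add0n => /existsP[t /eqP ew].
by have := inv2_wprod t; rewrite -ew ss size_tuple leq_double.
Qed.

End Length.

(** * Weak order on signed involutions *)

Section InvolutionWeakOrder.
Variable n : nat.
Implicit Types (x y : letter n) (u v w z f : {perm (letter n)}) (i : 'I_n).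

Definition comm i z : bool := wmul (simple i) (wmul z (simple i)) == z.

(** At an ascent this is the Demazure conjugate s o z o s, see [dem_conj]; at a descent it undoes
    such a step. One involutive map thus serves both directions. *)
Definition zstep i z : {perm (letter n)} :=
  if comm i z then wmul z (simple i) else wmul (simple i) (wmul z (simple i)).

Lemma commP i z : reflect (forall x, z (simple i x) = simple i (z x)) (comm i z).
Proof.
apply: (iffP eqP) => [e x|e].
  by rewrite -{2}e !wmulE !simpleK.
by apply/permP => x; rewrite !wmulE e simpleK.
Qed.

(* The letters moved by t_i form one orbit under t_i and negation. *)
Lemma comm_moved i z x : signed z -> simple i x != x ->
  z (simple i x) = simple i (z x) -> comm i z.
Proof.
move=> sz mx e.
have mzx : simple i (z x) != z x by rewrite -e (inj_eq perm_inj).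
have moved y : simple i y != y -> z (simple i y) = simple i (z y) /\ simple i (z y) != z y.
  move=> /(simple_moved2 mx)[]->;
    rewrite ?simple_signed ?sz ?simple_signed ?(inj_eq (@opp_inj n)) ?simpleK.
  - by [].
  - by rewrite e simpleK eq_sym.
  - by rewrite e.
  - by rewrite e simpleK eq_sym.
apply/commP => y; case: (eqVneq (simple i y) y) => [ey|/moved[]//].
rewrite ey; apply/eqP; rewrite eq_sym; apply/negPn/negP => mzy.
suff : simple i y != y by rewrite ey eqxx.
have [] := simple_moved2 mzx mzy; rewrite -?e -?sz => /perm_inj ->;
  by rewrite ?simple_opp_moved ?simpleK // eq_sym.
Qed.

Lemma signed_zstep i z : signed z -> signed (zstep i z).
Proof.
have ss := simple_signed i.
by rewrite /zstep => sz; case: ifP => _; do ?apply: signed_wmul.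
Qed.

Lemma involutive_zstep i z : involutive z -> involutive (zstep i z).
Proof.
move=> zK x; rewrite /zstep; case: ifP => [/commP e|_]; rewrite !wmulE.
  by rewrite e zK simpleK.
by rewrite simpleK zK simpleK.
Qed.

Lemma zstepK i z : zstep i (zstep i z) = z.
Proof.
rewrite {2}/zstep; case: ifP => [/commP e|nc].
  rewrite /zstep ifT ?wmul_simpleK //.
  by apply/commP => x; rewrite !wmulE e.
rewrite /zstep ifF; last first.
  apply: contraFF nc => /commP e; apply/commP => x; have := e (simple i x).
  by rewrite !wmulE !simpleK => <-; rewrite simpleK.
by rewrite -wmulA simple_wmulK wmul_simpleK.
Qed.

Lemma asc_zstep i z : signed z -> asc i (zstep i z) = ~~ asc i z.
Proof.
move=> sz; rewrite /zstep; case: ifP => [_|nc]; first exact: asc_simple.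
have ne : z (pos i) <> simple i (z (lo i)).
  move=> e; have := ltn_lo_hi i; move: nc => /negP[].
  apply: (@comm_moved i z (lo i)); rewrite ?simple_lo //.
  by apply/eqP => el; have := ltn_lo_hi i; rewrite el ltnn.
rewrite /asc !wmulE simple_lo simple_hi.
have [lt|le] := ltnP (z (lo i)) (z (pos i)).
  by have [lt'|//] := simple_lt i lt; apply/negbTE; rewrite -leqNgt ltnW.
have lt : z (pos i) < z (lo i).
  rewrite ltn_neqAle le andbT letter_eqE (inj_eq perm_inj).
  by apply/eqP => el; have := ltn_lo_hi i; rewrite el ltnn.
have [//|e] := simple_lt i lt.
by case: ne; rewrite e simpleK.
Qed.

Lemma comm_zstep i z : comm i (zstep i z) = comm i z.
Proof.
apply/commP/commP => e x; last by rewrite /zstep; case: ifP => _; rewrite !wmulE ?e ?simpleK.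
have := e x; rewrite /zstep; case: ifP => [/commP->//|_].
by rewrite !wmulE !simpleK => ->.
Qed.

(** As z x is moved by s too, it is one of x, s x, - x, - s x; the values s x and - x would make z
    reverse the neighbours x and s x. *)
Lemma asc_comm i z x : signed z -> asc i z -> comm i z -> simple i x != x ->
  z x = x \/ z x = opp (simple i x) /\ z x != x.
Proof.
move=> sz a /commP e mx; case: (eqVneq (z x) x) => [|ne]; [by left|right; split=> //].
have mzx : simple i (z x) != z x by rewrite -e (inj_eq perm_inj).
have [e1|e1|e1|//] := simple_moved2 mx mzx; first by rewrite e1 eqxx in ne.
  have [lt|] := ltnP x (simple i x).
    by have := asc_lt sz a lt; rewrite e e1 simpleK ltnNge ltnW.
  rewrite leq_eqVlt letter_eqE (negPf mx) /= -{2}(simpleK i x) => lt.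
  by have := asc_lt sz a lt; rewrite simpleK e e1 simpleK ltnNge ltnW // -{2}(simpleK i x).
have [lt|] := ltnP x (simple i x).
  by have := asc_lt sz a lt; rewrite e e1 simple_signed ltn_opp ltnNge ltnW.
rewrite leq_eqVlt letter_eqE (negPf mx) /= -{2}(simpleK i x) => lt.
have := asc_lt sz a lt; rewrite simpleK e e1 simple_signed ltn_opp ltnNge ltnW //.
by rewrite -{2}(simpleK i x).
Qed.

End InvolutionWeakOrder.

(** * Demazure products with a simple generator *)

Section Demazure.
Variable n : nat.
Implicit Types (x y : letter n) (u v w z f : {perm (letter n)}) (i : 'I_n).
Variable dem : {perm (letter n)} -> {perm (letter n)} -> {perm (letter n)}.
Hypothesis dd : is_demazure dem.

Lemma len_wmul_simple i w : signed w -> asc i w -> len (wmul w (simple i)) = (len w).+1.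
Proof.
move=> sw a; have sws := signed_wmul sw (simple_signed i).
by apply: double_inj; rewrite doubleS !lenE // inv2_asc // addn2.
Qed.

Lemma asc1 i : asc i (1 : {perm letter n}).
Proof. by rewrite /asc !perm1 ltn_lo_hi. Qed.

Lemma len_simple i : len (simple i) = 1.
Proof.
rewrite -[simple i]mulg1 -/(wmul _ _) len_wmul_simple ?asc1 //; last exact: signed1.
by congr _.+1; apply: double_inj; rewrite lenE ?inv2_1 //; apply: signed1.
Qed.

Lemma len_inv w : signed w -> len w^-1%g = len w.
Proof.
by move=> sw; apply: double_inj; rewrite !lenE ?inv2V //; apply: signedV.
Qed.

Lemma dem_simple_r i w : signed w ->
  dem w (simple i) = if asc i w then wmul w (simple i) else w.
Proof.
have asc_case u : signed u -> asc i u -> dem u (simple i) = wmul u (simple i).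
  move=> su a; apply: (dem_reduced dd) => //; first exact: simple_signed.
  by rewrite len_wmul_simple // len_simple addn1.
move=> sw; case: ifP => [|/negbT d]; first exact: asc_case.
(* At a descent, w = (w s) o s with w s ascending; associativity and s o s = s then give w o s =
   w. *)
have sws := signed_wmul sw (simple_signed i).
have a : asc i (wmul w (simple i)) by rewrite asc_simple.
have e := asc_case _ sws a; rewrite wmul_simpleK in e.
rewrite -{1}e -(dem_assoc dd) // ?(dem_idem dd) //; exact: simple_signed.
Qed.

Lemma dem_simple_l i w : signed w ->
  dem (simple i) w = if asc i w^-1%g then wmul (simple i) w else w.
Proof.
have ss := simple_signed i.
have asc_case u : signed u -> asc i u^-1%g -> dem (simple i) u = wmul (simple i) u.
  move=> su a; apply: (dem_reduced dd) => //.
  rewrite -len_inv; last exact: signed_wmul.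
  rewrite wmul_inv simpleV len_wmul_simple //; last exact: signedV.
  by rewrite len_inv // len_simple.
move=> sw; case: ifP => [|/negbT d]; first exact: asc_case.
have sws := signed_wmul ss sw.
have a : asc i (wmul (simple i) w)^-1%g by rewrite wmul_inv simpleV asc_simple.
have e := asc_case _ sws a; rewrite simple_wmulK in e.
by rewrite -{1}e (dem_assoc dd) // (dem_idem dd).
Qed.

Lemma involutiveV z : involutive z -> z^-1%g = z.
Proof. by move=> zK; apply/permP => x; apply: (@perm_inj _ z); rewrite permKV zK. Qed.

Lemma dem_conj i z : signed z -> involutive z ->
  dem (simple i) (dem z (simple i)) = if asc i z then zstep i z else z.
Proof.
move=> sz zK; have sws := signed_wmul sz (simple_signed i).
rewrite dem_simple_r //; case: ifP => a; last first.
  by rewrite dem_simple_l // involutiveV // a.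
rewrite dem_simple_l // wmul_inv simpleV involutiveV // /zstep.
have [/commP e|/negP nc] := boolP (comm i z).
  have -> : wmul (simple i) z = wmul z (simple i).
    by apply/permP => x; rewrite !wmulE e.
  by rewrite asc_simple a.
rewrite ifT // /asc !wmulE.
have [//|e] := simple_lt i a.
case: nc; apply: (@comm_moved n i z (lo i)) => //; rewrite simple_lo //.
by apply/eqP => el; have := ltn_lo_hi i; rewrite el ltnn.
Qed.

Lemma dem_inv_step i w : signed w -> asc i w ->
  dem (wmul w (simple i))^-1%g (wmul w (simple i)) =
  dem (simple i) (dem (dem w^-1%g w) (simple i)).
Proof.
move=> sw a; have swV := signedV sw; have ss := simple_signed i.
have e1 : wmul w (simple i) = dem w (simple i) by rewrite dem_simple_r // a.
have e2 : (wmul w (simple i))^-1%g = dem (simple i) w^-1%g.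
  by rewrite dem_simple_l // invgK a wmul_inv simpleV.
rewrite e2 e1 -(dem_assoc dd) //; last exact: (dem_closed dd).
by congr dem; rewrite (dem_assoc dd).
Qed.

End Demazure.

(** * Block structure of atoms *)

Section Chains.
Variable n : nat.
Implicit Types (x y : letter n) (u v w z f : {perm (letter n)}) (i : 'I_n).

Definition merging i z : bool :=
  [&& i != 0 :> nat, z (lo i) == lo i & z (pos i) == pos i].

(** In a merging step f fixes both letters, and conjugation would leave them unpaired but in
    descending order; the product with s pairs them instead. *)
Definition fstep i z f : {perm (letter n)} :=
  if merging i z then wmul f (simple i) else wmul (simple i) (wmul f (simple i)).

Inductive chain : {perm (letter n)} -> {perm (letter n)} -> {perm (letter n)} -> Prop :=
| chain_nil : chain 1%g 1%g 1%g
| chain_cons i z w f : chain z w f -> asc i z ->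
    chain (zstep i z) (wmul w (simple i)) (fstep i z f).

(* The letters x of the word of w^-1 are those with w x positive, and w x is
   the position of x in it; f x is the letter deleted together with x, or x
   itself if x is not deleted. *)
Record blocks z w f : Prop := Blocks {
  blocks_z : signed z;
  blocks_zK : involutive z;
  blocks_w : signed w;
  blocks_f : signed f;
  blocks_fK : involutive f;
  blocks_word x : positive (w x) -> positive (w (f x));
  blocks_order x : positive (w x) -> w x < w (f x) -> f x < x /\ positive x;
  blocks_between x y : positive (w x) -> w x < w y -> w y < w (f x) ->
    ~ (f x < y /\ y < x);
  blocks_apart x y : positive (w x) -> positive (w y) -> x < y -> f x < f y ->
    w x < w y /\ w x < w (f y);
  blocks_max x : positive (w x) -> z x = maxn (f x) (opp x) :> nat;
  blocks_noncrossing x y : z x = opp x -> z y = opp y ->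
    x < y -> y < opp (f x) -> opp (f x) < opp (f y) -> False }.

Lemma blocks1 : blocks 1%g 1%g 1%g.
Proof.
split; try by move=> x; rewrite !perm1.
- by move=> x y; rewrite !perm1 => _ h1 h2; lia.
- by move=> x y _ _ lt _; rewrite !perm1.
- by move=> x; rewrite !perm1 positiveE => h; rewrite (maxn_idPl _) // ltnW.
- by move=> x y /eqP; rewrite perm1 eq_sym (negPf (opp_neq x)).
Qed.

Section BlocksTheory.
Variables (z w f : {perm (letter n)}).
Hypothesis bl : blocks z w f.
Let sz := blocks_z bl.
Let sw := blocks_w bl.
Let sf := blocks_f bl.
Let fK := blocks_fK bl.

Lemma word_opp x : positive (w (opp x)) = ~~ positive (w x).
Proof. by rewrite sw positive_opp. Qed.

Lemma blocks_neq_opp x : positive (w x) -> f x != opp x.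
Proof.
move=> px; apply/eqP => e; have := blocks_word bl px.
by rewrite e word_opp px.
Qed.

Lemma blocks_max_lt x : positive (w x) -> f x < opp x -> z x = opp x.
Proof. by move=> px lt; apply/ord_inj; rewrite (blocks_max bl px); lia. Qed.

Lemma blocks_max_gt x : positive (w x) -> opp x < f x -> z x = f x.
Proof. by move=> px lt; apply/ord_inj; rewrite (blocks_max bl px); lia. Qed.

(** For a letter of the word, being negated by z amounts to f x < - x, a condition symmetric in x
    and f x. *)
Lemma blocks_neg x : z x = opp x -> z (f x) = opp (f x).
Proof.
have main y : positive (w y) -> z y = opp y -> z (f y) = opp (f y).
  move=> py e; apply/ord_inj.
  rewrite (blocks_max bl (blocks_word bl py)) fK.
  have := blocks_max bl py; rewrite e !oppE; have := ltn_ord y; have := ltn_ord (f y); lia.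
have [px|nx] := boolP (positive (w x)); first exact: main.
move=> e; have := main (opp x); rewrite word_opp sz e sf sz => /(_ nx erefl).
by move/opp_inj.
Qed.

Lemma blocks_fixed x : z x = x -> f x = x.
Proof.
have main y : positive (w y) -> z y = y -> f y = y.
  move=> py e; have := letter_neq_lt (blocks_neq_opp py).
  case/orP => lt; last by rewrite -(blocks_max_gt py lt).
  by have := opp_neq y; rewrite -(blocks_max_lt py lt) e eqxx.
have [px|nx] := boolP (positive (w x)); first exact: main.
move=> e; have := main (opp x); rewrite word_opp sz e sf => /(_ nx erefl).
by move/opp_inj.
Qed.

End BlocksTheory.

(** * An ascent preserves the block structure *)

Section Step.
Variables (i : 'I_n) (z w f : {perm (letter n)}).
Hypotheses (bl : blocks z w f) (a : asc i z).
Let s := simple i.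
Let sK : involutive s. Proof. exact: simpleK. Qed.
Let ss : signed s. Proof. exact: simple_signed. Qed.
Let sz := blocks_z bl.
Let zK := blocks_zK bl.
Let sw := blocks_w bl.
Let sf := blocks_f bl.
Let fK := blocks_fK bl.
Let zlt x : x < s x -> z x < z (s x). Proof. exact: asc_lt. Qed.

(* The maximum formula turns an ascent of z between two letters of the word
   into an ascent of f. *)
Lemma asc_blocks x : x < s x -> positive (w x) -> positive (w (s x)) -> f x < f (s x).
Proof.
move=> lt px psx; have := zlt lt.
rewrite (blocks_max bl px) (blocks_max bl psx).
by have := ltn_opp (s x) x; rewrite lt; lia.
Qed.

Lemma asc_word x : x < s x -> w x < w (s x).
Proof.
move=> lt.
have [px|nx] := boolP (positive (w x)); have [psx|nsx] := boolP (positive (w (s x))).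
- by have [] := blocks_apart bl px psx lt (asc_blocks lt px psx).
(* If x is in the word and s x is not, then - s x is, and the maximum formula gives z (s x) <= - s x
   < - x <= z x, against the ascent. *)
- have := zlt lt; have psx : positive (w (opp (s x))) by rewrite (word_opp bl).
  have := blocks_max bl psx; rewrite (blocks_max bl px) oppK sz => e.
  by rewrite gtn_max => /andP[_]; rewrite ltn_oppl; move: e lt; rewrite -/s; lia.
- by move: nx psx; rewrite /positive; lia.
- rewrite -ltn_opp -!sw.
  have lt' : opp (s x) < s (opp (s x)) by rewrite ss sK ltn_opp.
  have p1 : positive (w (opp (s x))) by rewrite (word_opp bl).
  have p2 : positive (w (s (opp (s x)))) by rewrite ss sK (word_opp bl).
  by have [] := blocks_apart bl p1 p2 lt' (asc_blocks lt' p1 p2); rewrite ss sK.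
Qed.

Lemma simple_lt_inv x y : s x < s y -> x < y \/ y < x /\ s y = x.
Proof.
move=> lt; have [|e] := simple_lt i lt; first by rewrite -/s !sK; left.
rewrite -/s sK in e; right; split=> //.
have e' : s x = y by rewrite -e sK.
by move: lt; rewrite e e'.
Qed.

(** For a letter of the word the maximum of f x and - x is - s x, which differs from - x, so it is f
    x; the other letters follow by negation. *)
Lemma blocks_mirror x : z x = opp (s x) -> z x != x -> s x != x -> f x = opp (s x).
Proof.
have main y : positive (w y) -> z y = opp (s y) -> s y != y -> f y = opp (s y).
  move=> py e my; have := letter_neq_lt (blocks_neq_opp bl py).
  case/orP => lt; last by rewrite -(blocks_max_gt bl py lt).
  by move: my; have := blocks_max_lt bl py lt; rewrite e => /opp_inj->; rewrite eqxx.
have [px|nx] := boolP (positive (w x)); first by move=> e _; apply: main.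
move=> e _ m; have := main (opp x); rewrite (word_opp bl) sz e sf ss => /(_ nx erefl).
by rewrite (inj_eq (@opp_inj n)) => /(_ m)/opp_inj.
Qed.

(** Here and in the lemmas named alike, a clause of [blocks] is checked for s f s and w s at x, and
    read at the old letter X = s x. The order of f X and X turns only if s exchanges them, the sign
    changes only at t_0, and both contradict the ascent. *)
Lemma fstep_order x (X := s x) : positive (w X) -> w X < w (f X) ->
  s (f X) < x /\ positive x.
Proof.
rewrite -[x](sK x) -/X => px lt; have [lt' pX] := blocks_order bl px lt.
have pf := blocks_word bl px; split.
  have [//|e] := simple_lt i lt'; rewrite -/s in e.
  have := @asc_blocks (f X); rewrite -e fK => /(_ lt' pf px).
  by rewrite ltnNge ltnW.
apply/negPn/negP => np; have e : s X = opp X.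
  by apply: simple_cross; rewrite pX (negPf np).
have lt1 : opp X < s (opp X) by rewrite ss e oppK -positiveE.
have ltf : f X < opp X.
  have := simple_gtS lt1; rewrite -/s ss e oppK => eX.
  have := blocks_neq_opp bl px; rewrite -letter_eqE; lia.
have := zlt lt1; rewrite ss e oppK sz (blocks_max_lt bl px ltf) oppK.
by rewrite ltnNge ltnW // -positiveE.
Qed.

Lemma fstep_between x y (X := s x) (Y := s y) : positive (w X) ->
  w X < w Y -> w Y < w (f X) -> ~ (s (f X) < y /\ y < x).
Proof.
rewrite -[x](sK x) -[y](sK y) -/X -/Y => px l1 l2.
have py : positive (w Y) by move: px; rewrite /positive; lia.
have pf := blocks_word bl px.
move=> [/simple_lt_inv[h1|[h1 e1]] /simple_lt_inv[h2|[h2 e2]]].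
- exact: (blocks_between bl px l1 l2).
- have psx : positive (w (s X)) by rewrite e2.
  have lt : X < s X by rewrite e2.
  have := asc_blocks lt px psx; rewrite e2 => ltf.
  by have [] := blocks_apart bl pf (blocks_word bl py) ltf; rewrite !fK //; lia.
- have psy : positive (w (s Y)) by rewrite e1.
  have lt : Y < s Y by rewrite e1.
  have := asc_blocks lt py psy => ltf.
  by have [] := blocks_apart bl py psy lt ltf; rewrite e1 fK; lia.
- have psy : positive (w (s Y)) by rewrite e1.
  have lt : Y < s Y by rewrite e1.
  have := asc_blocks lt py psy => ltf.
  by have [] := blocks_apart bl py psy lt ltf; rewrite e1 fK; lia.
Qed.

(** Exchanging two unpaired neighbours of the word would create a descent that is no pair. Such
    letters are positive, since z would otherwise negate both and descend there; hence z fixes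
    them. *)
Lemma merging_pair x : x < s x -> positive (w x) -> positive (w (s x)) ->
  f x = x -> f (s x) = s x -> merging i z.
Proof.
move=> lt px psx e es.
have ne : s x != opp x by apply/eqP => ee; move: psx; rewrite ee (word_opp bl) px.
have pp : positive x = positive (s x).
  by have [//|/simple_cross/eqP e'] := eqVneq (positive x) (positive (s x)); rewrite e' in ne.
have pos : positive x.
  rewrite positiveE; apply/negPn; rewrite -leqNgt; apply/negP => le.
  have ltx : f x < opp x by rewrite e ltn_neqAle le letter_eqE eq_sym opp_neq.
  have ltsx : f (s x) < opp (s x).
    by rewrite es; move: pp; rewrite !positiveE; have := opp_neq (s x); rewrite -letter_eqE; lia.
  have := zlt lt; rewrite (blocks_max_lt bl px ltx) (blocks_max_lt bl psx ltsx).
  by rewrite ltn_opp; lia.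
have zx : z x = x by rewrite (blocks_max_gt bl px) e // -positiveE.
have zsx : z (s x) = s x by rewrite (blocks_max_gt bl psx) es // -positiveE -pp.
have [[e1 e2]|[e1 _]] := simple_gt lt; last first.
  by move: pos; rewrite e1 positive_opp positive_pos.
rewrite /merging -e2 -e1 -/s zx zsx !eqxx !andbT.
by apply: contraNneq ne => i0; apply/eqP/simple0 => //; rewrite -/s -letter_eqE; lia.
Qed.

(** * Steps that relabel the letters *)

Section NonMerging.
Hypothesis nm : ~~ merging i z.

Lemma fstep_apart x y (X := s x) (Y := s y) :
  positive (w X) -> positive (w Y) -> x < y -> s (f X) < s (f Y) ->
  w X < w Y /\ w X < w (f Y).
Proof.
rewrite -[x](sK x) -[y](sK y) -/X -/Y => px py.
have pfx := blocks_word bl px; have pfy := blocks_word bl py.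
move=> /simple_lt_inv[h1|[h1 e1]] /simple_lt_inv[h2|[h2 e2]].
- exact: (blocks_apart bl px py).
- have := @asc_blocks (f Y); rewrite e2 !fK => /(_ h2 pfy pfx); lia.
- have := @asc_blocks Y; rewrite e1 => /(_ h1 py px); lia.
(* Both orders turn only if s exchanges Y with X and f Y with f X. Then f Y is Y, X, - Y or - X; the
   first is a merging, the others are impossible. *)
- have mY : s Y != Y by rewrite e1 -letter_eqE; lia.
  have mfY : s (f Y) != f Y by rewrite e2 -letter_eqE; lia.
  have [eq|eq|eq|eq] := simple_moved2 mY mfY; rewrite -/s ?e1 in eq.
  + case/negP: nm; apply: (@merging_pair Y); rewrite ?e1 ?eq //.
    by rewrite -e2 eq e1.
  + have eX : f X = Y by rewrite -eq fK.
    by move: h2; rewrite eq eX; lia.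
  + by move: (blocks_neq_opp bl py); rewrite eq eqxx.
  + by move: pfy; rewrite eq (word_opp bl) px.
Qed.

(** Applying s commutes with the maximum of f x and - x unless s exchanges these two letters; then f
    x = - s x, and z would commute with s at a moved letter. *)
Lemma noncomm_max x : ~~ comm i z -> positive (w x) ->
  s (z x) = maxn (s (f x)) (opp (s x)) :> nat.
Proof.
move=> nc px; have moved_comm y : z (s y) = s (z y) -> s y = y.
  move=> e; apply/eqP/negPn/negP => m; case/negP: nc.
  exact: (@comm_moved n i z y).
rewrite -ss; have [lt|] := orP (letter_neq_lt (blocks_neq_opp bl px)).
  rewrite (blocks_max_lt bl px lt); have [|e] := simple_lt i lt; first by rewrite -/s; lia.
  rewrite -/s in e; have ef : f x = opp (s x) by rewrite -ss e sK.
  have pf := blocks_word bl px.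
  have zf : z (f x) = s x.
    rewrite (blocks_max_lt bl pf) ?fK ef ?oppK //.
    by move: lt; rewrite ef ltn_opp.
  have /moved_comm ex : z (s x) = s (z x).
    rewrite (blocks_max_lt bl px lt) ss.
    by apply: opp_inj; rewrite oppK -sz -ef zf.
  by have := blocks_neq_opp bl px; rewrite ef ex eqxx.
move=> gt; rewrite (blocks_max_gt bl px gt).
have [|e] := simple_lt i gt; first by rewrite -/s; lia.
rewrite -/s ss in e; have /moved_comm ex : z (s x) = s (z x).
  rewrite (blocks_max_gt bl px gt) e ss sK.
  have : z (f x) = x by rewrite -(blocks_max_gt bl px gt) zK.
  by rewrite e sz => h; apply: opp_inj; rewrite oppK.
by have := blocks_neq_opp bl px; rewrite e ex eqxx.
Qed.

(** For a moved x, [asc_comm] leaves two cases. A fixed point outside a merging forces t_0, where s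
    x = - x; and z x = - s x gives f x = - s x, so that s exchanges the two terms of the maximum. *)
Lemma comm_max x : comm i z -> positive (w x) ->
  z x = maxn (s (f x)) (opp (s x)) :> nat.
Proof.
move=> c px; have [ex|mx] := eqVneq (s x) x.
  have mz : s (z x) = z x by rewrite -(commP i z c) -/s ex.
  have [lt|gt'] := orP (letter_neq_lt (blocks_neq_opp bl px)).
    rewrite (blocks_max_lt bl px lt) ex.
    have [|e] := simple_lt i lt; rewrite -/s; first by rewrite ss ex; lia.
    by have := blocks_neq_opp bl px; rewrite -[f x]sK -/s -e ss ex eqxx.
  by move: mz (gt'); rewrite (blocks_max_gt bl px gt') ex => ->; lia.
have [e|[e ne]] := asc_comm sz a c mx.
  have ef := blocks_fixed bl e.
  have pos : positive x.
    rewrite positiveE; have := blocks_max bl px; rewrite e ef.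
    by have := opp_neq x; rewrite -letter_eqE; lia.
  have e' : s x = opp x.
    case: (eqVneq (i : nat) 0) => [i0|i0]; first exact: simple0.
    case/negP: nm; rewrite /merging i0.
    have zs : z (s x) = s x by rewrite (commP i z c) e.
    have [ee|ee|ee|ee] := simple_moved mx.
    - by rewrite -simple_lo -ee -/s e zs !eqxx.
    - by rewrite -simple_hi -ee -/s e zs !eqxx.
    - by move: pos; rewrite ee positive_opp positive_lo.
    - by move: pos; rewrite ee positive_opp positive_pos.
  by rewrite e ef e' oppK; move: pos; rewrite positiveE; lia.
have ef := blocks_mirror e ne mx.
have := blocks_max bl px; rewrite e ef => h.
by rewrite ss sK; lia.
Qed.

Lemma zstep_max x (X := s x) : positive (w X) ->
  zstep i z x = maxn (s (f X)) (opp x) :> nat.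
Proof.
rewrite -[x](sK x) -/X /zstep => px.
case: (boolP (comm i z)) => c; rewrite !wmulE sK.
  by rewrite (comm_max c px).
by rewrite (noncomm_max c px).
Qed.

(** The hypothesis says that the step makes x negated. The conclusion describes its new block: {x, -
    f x} becomes {x, s x}, which is {x, - x} for t_0. *)
Lemma fstep_moved x : s x != x -> comm i z -> z (s x) = opp x -> s (f (s x)) = opp (s x).
Proof.
move=> mx c e; have mX : s (s x) != s x by rewrite sK eq_sym.
have [e1|[e1 ne]] := asc_comm sz a c mX.
  by rewrite (blocks_fixed bl e1) sK -e1 e oppK.
by rewrite (blocks_mirror e1 ne mX) -/s sK ss.
Qed.

Lemma fstep_unmoved x : s x = x -> comm i z -> z x = opp x -> s (f x) = f x.
Proof.
move=> ex c e; apply/eqP/negPn/negP => m.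
have zf := blocks_neg bl e.
have [e1|[e1 ne]] := asc_comm sz a c m; rewrite zf in e1.
  by have := opp_neq (f x); rewrite e1 eqxx.
by move: m; rewrite -(inj_eq (@opp_inj n)) e1 eqxx.
Qed.

(** z reverses the order of negated letters, so an ascent cannot exchange two of them. *)
Lemma neg_lt x y : z x = opp x -> z y = opp y -> s x < s y -> x < y.
Proof.
move=> ex ey /simple_lt_inv[//|[lt e]].
have := @zlt y; rewrite e ex ey ltn_opp => /(_ lt); lia.
Qed.

Lemma fstep_noncrossing x y (g := fun x => s (f (s x))) :
  zstep i z x = opp x -> zstep i z y = opp y ->
  x < y -> y < opp (g x) -> opp (g x) < opp (g y) -> False.
Proof.
rewrite /zstep; case: (boolP (comm i z)) => c; rewrite !wmulE -/s; last first.
  move=> ex ey; have ex' : z (s x) = opp (s x) by rewrite -ss -ex sK.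
  have ey' : z (s y) = opp (s y) by rewrite -ss -ey sK.
  have efx : z (opp (f (s x))) = opp (opp (f (s x))) by rewrite sz (blocks_neg bl).
  have efy : z (opp (f (s y))) = opp (opp (f (s y))) by rewrite sz (blocks_neg bl).
  move=> h1 h2 h3; apply: (blocks_noncrossing bl ex' ey').
  - by apply: (neg_lt ex' ey'); rewrite !sK.
  - by apply: (neg_lt ey' efx); rewrite sK ss.
  - by apply: (neg_lt efx efy); rewrite !ss.
move=> ex ey h1.
(* The block of a moved letter is {x, s x}, made of neighbours, with no room for an end of a
   crossing block. *)
have [sx|mx] := eqVneq (s x) x; last first.
  rewrite /g (fstep_moved mx c ex) oppK => h2 _.
  by have := simple_gtS (ltn_trans h1 h2); rewrite -/s; lia.
have [sy|my] := eqVneq (s y) y; last first.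
  rewrite /g (fstep_moved my c ey) oppK => h2 h3.
  by have := simple_gtS (ltn_trans h2 h3); rewrite -/s; lia.
rewrite sx in ex; rewrite sy in ey; rewrite /g sx sy !fstep_unmoved //.
exact: (blocks_noncrossing bl ex ey h1).
Qed.

Lemma blocks_fstep : blocks (zstep i z) (wmul w s) (wmul s (wmul f s)).
Proof.
split.
- exact: signed_zstep.
- exact: involutive_zstep.
- exact: signed_wmul.
- exact: signed_wmul ss (signed_wmul sf ss).
- by move=> x; rewrite !wmulE sK fK sK.
- by move=> x; rewrite !wmulE sK; apply: (blocks_word bl).
- by move=> x; rewrite !wmulE sK; apply: fstep_order.
- by move=> x y; rewrite !wmulE sK; apply: fstep_between.
- by move=> x y; rewrite !wmulE sK; apply: fstep_apart.
- by move=> x; rewrite !wmulE; apply: zstep_max.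
- by move=> x y; rewrite !wmulE; apply: fstep_noncrossing.
Qed.

End NonMerging.

(** * Steps that merge two fixed letters *)

Section Merging.
Hypothesis m : merging i z.

Lemma merging_fixed x : s x != x -> z x = x.
Proof.
have /and3P[_ /eqP zl /eqP zh] := m.
by move=> /simple_moved[]->; rewrite ?sz ?zl ?zh.
Qed.

Lemma merging_comm : comm i z.
Proof.
have /and3P[_ /eqP zl /eqP zh] := m.
apply: (@comm_moved n i z (lo i)) => //; rewrite simple_lo; last by rewrite zl zh simple_lo.
by rewrite -letter_eqE; have := ltn_lo_hi i; lia.
Qed.

Lemma merging_f x : s x != x -> f x = x.
Proof. by move=> /merging_fixed/(blocks_fixed bl). Qed.

Lemma merging_unmoved x : s x = x -> s (f x) = f x.
Proof.
move=> ex; apply/eqP/negPn/negP => mf.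
by have e := merging_f mf; move: mf; rewrite -e fK ex eqxx.
Qed.

(** For a letter of the word fixed by z and f the maximum formula reads x = max (x, - x), which
    makes it positive. *)
Lemma merging_word x : s x != x -> positive (w x) = positive x.
Proof.
have main y : s y != y -> positive (w y) -> positive y.
  move=> my py; have := blocks_max bl py; rewrite merging_fixed // merging_f //.
  by rewrite positiveE; have := opp_neq y; rewrite -letter_eqE; lia.
move=> mx; apply/idP/idP; first exact: main.
move=> px; apply: contraTT px; rewrite -(word_opp bl) -positive_opp => /main->;
  by rewrite // simple_opp_moved.
Qed.

Lemma merging_lohi x : s x != x -> positive (w x) -> x = lo i \/ x = pos i.
Proof.
have /and3P[i0 _ _] := m => mx; rewrite merging_word //.
have [] := simple_moved mx; [by left|by right|..] => ->.
  by rewrite positive_opp positive_lo.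
by rewrite positive_opp positive_pos.
Qed.

Lemma merging_lohi' x : s x != x -> positive (w (s x)) ->
  x = pos i /\ s x = lo i \/ x = lo i /\ s x = pos i.
Proof.
move=> mx; have m' : s (s x) != s x by rewrite sK eq_sym.
move=> /(merging_lohi m')[]e; [left|right];
  by split=> //; rewrite -(sK x) e /s ?simple_lo ?simple_hi.
Qed.

Lemma merging_moved : (s (lo i) != lo i) /\ (s (pos i) != pos i).
Proof.
rewrite /s simple_lo simple_hi; have := ltn_lo_hi i.
by rewrite -!letter_eqE; lia.
Qed.

Lemma unmoved_lt x y : s x = x -> (x < s y -> x < y) /\ (s y < x -> y < x).
Proof.
move=> ex; split => lt.
  move: lt; rewrite -{1}ex => /simple_lt_inv[//|[lt' e]].
  by move: lt'; rewrite -(sK y) e ex ltnn.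
move: lt; rewrite -{1}ex => /simple_lt_inv[//|[lt' e]].
by move: lt'; rewrite -e ex ltnn.
Qed.

(** In the new word [pos i] precedes [lo i]; being neighbours in value they have no letter between
    them, and all unmoved letters keep their partners. *)
Lemma blocks_merge : blocks (zstep i z) (wmul w s) (wmul f s).
Proof.
have /and3P[i0 /eqP zl /eqP zh] := m.
have ltlh := ltn_lo_hi i.
have [ml mh] := merging_moved.
have fl := merging_f ml; have fh := merging_f mh.
have pl : positive (w (lo i)) by rewrite merging_word ?positive_lo.
have ph : positive (w (pos i)) by rewrite merging_word ?positive_pos.
have wlh : w (lo i) < w (pos i).
  by have := @asc_word (lo i); rewrite /s simple_lo; apply.
have sl : s (lo i) = pos i by exact: simple_lo.
have sh : s (pos i) = lo i by exact: simple_hi.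
have c := merging_comm.
have zE x : zstep i z x = z (s x) by rewrite /zstep c wmulE.
have um := @unmoved_lt.
have F1 : (pos i < lo i) = false by rewrite ltnNge (ltnW ltlh).
have F2 : (w (pos i) < w (lo i)) = false by rewrite ltnNge (ltnW wlh).
split.
- exact: signed_zstep.
- exact: involutive_zstep.
- exact: signed_wmul.
- exact: signed_wmul.
- move=> x; rewrite !wmulE; case: (eqVneq (s x) x) => [ex|mx].
    by rewrite ex merging_unmoved // fK.
  by rewrite (@merging_f (s x)) sK ?merging_f // eq_sym.
- move=> x; rewrite !wmulE; case: (eqVneq (s x) x) => [ex|mx].
    by rewrite ex merging_unmoved //; apply: (blocks_word bl).
  have m' : s (s x) != s x by rewrite sK eq_sym.
  by rewrite (merging_f m') => /(merging_lohi m')[]->; rewrite ?sl ?sh.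
- move=> x; rewrite !wmulE; case: (eqVneq (s x) x) => [ex|mx].
    by rewrite ex merging_unmoved //; apply: (blocks_order bl).
  have m' : s (s x) != s x by rewrite sK eq_sym.
  rewrite (merging_f m') => /(merging_lohi' mx)[[-> ->]|[-> ->]]; last by rewrite sh F2.
  by rewrite positive_pos.
- move=> x y; rewrite !wmulE; case: (eqVneq (s x) x) => [ex|mx].
    rewrite ex merging_unmoved // => px l1 l2 [l3 l4].
    apply: (blocks_between bl px l1 l2); split.
      by apply: (um _ _ (merging_unmoved ex)).1; rewrite sK.
    by apply: (um _ _ ex).2; rewrite sK.
  have m' : s (s x) != s x by rewrite sK eq_sym.
  rewrite (merging_f m') => /(merging_lohi' mx)[[-> ->]|[-> ->]]; last first.
    by rewrite sh => l1 l2; have := ltn_trans l1 l2; rewrite F2.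
  by move=> _ _ [l1]; rewrite hi_lo ltnS leqNgt l1.
- move=> x y; rewrite !wmulE => px py.
  case: (eqVneq (s x) x) => [ex|mx]; case: (eqVneq (s y) y) => [ey|my].
  + by rewrite ex ey merging_unmoved // in px py *; apply: (blocks_apart bl).
  (* The old f fixes both s y and y; comparing x with each of them gives the two claims. *)
  + have m' : s (s y) != s y by rewrite sK eq_sym.
    rewrite ex in px *; rewrite (merging_f m') sK => l1 l2.
    have l1' := (um _ (s y) ex).1; rewrite sK in l1'.
    have l2' := (um _ y (merging_unmoved ex)).1 l2.
    have py' : positive (w y) by have [[-> _]|[-> _]] := merging_lohi' my py.
    have [h1 _] := blocks_apart bl px py (l1' l1)
      (eq_ind_r (fun t => f x < nat_of_ord t) l2 (merging_f m')).
    have [h2 _] := blocks_apart bl px py' l1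
      (eq_ind_r (fun t => f x < nat_of_ord t) l2' (merging_f my)).
    by [].
  + have m' : s (s x) != s x by rewrite sK eq_sym.
    rewrite ey in py *; rewrite (merging_f m') merging_unmoved // => l1 l2.
    have l1' := (um y (s x) ey).2; rewrite sK in l1'.
    by apply: (blocks_apart bl px py (l1' l1)); rewrite merging_f.
  + have mx' : s (s x) != s x by rewrite sK eq_sym.
    have my' : s (s y) != s y by rewrite sK eq_sym.
    rewrite (merging_f mx') (merging_f my').
    by have [[-> ->]|[-> ->]] := merging_lohi' mx px;
      have [[-> ->]|[-> ->]] := merging_lohi' my py; rewrite ?ltnn ?F1.
- move=> x; rewrite !wmulE zE => px; case: (eqVneq (s x) x) => [ex|mx].
    by rewrite ex in px *; apply: (blocks_max bl).
  have m' : s (s x) != s x by rewrite sK eq_sym.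
  rewrite (merging_f m') merging_fixed //.
  have := positive_pos i; have := positive_lo i0; rewrite !positiveE.
  have := ltn_opp (pos i) (lo i).
  by have [[-> ->]|[-> ->]] := merging_lohi' mx px; clear -ltlh; lia.
- have neg x : zstep i z x = opp x -> z x = opp x /\ f (s x) = f x.
    rewrite zE; case: (eqVneq (s x) x) => [->//|mx].
    rewrite merging_fixed ?sK 1?eq_sym // => /simple_oppE i0'.
    by rewrite i0' in i0.
  move=> x y; rewrite !wmulE => /neg[ex ->] /neg[ey ->].
  exact: (blocks_noncrossing bl).
Qed.

End Merging.

Lemma blocks_step : blocks (zstep i z) (wmul w s) (fstep i z f).
Proof.
by rewrite /fstep; case: ifP => [/blocks_merge|/negbT/blocks_fstep].
Qed.

End Step.

Lemma chain_blocks z w f : chain z w f -> blocks z w f.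
Proof.
elim=> [|i z' w' f' _ IH a]; first exact: blocks1.
exact: blocks_step.
Qed.

End Chains.

(** * Atoms as chains *)

Section Atoms.
Variable n : nat.
Implicit Types (x y : letter n) (u v w z f : {perm (letter n)}) (i : 'I_n).

Lemma noncomm_asc i z : signed z -> asc i z -> ~~ comm i z -> asc i (wmul (simple i) z).
Proof.
move=> sz a; rewrite /asc !wmulE => nc; have [//|e] := simple_lt i a.
case/negP: nc; apply: (@comm_moved n i z (lo i)) => //; rewrite simple_lo //.
by rewrite -letter_eqE; have := ltn_lo_hi i; lia.
Qed.

Lemma inv2_zstep i z : signed z -> involutive z -> asc i z ->
  inv2 (zstep i z) = inv2 z + (if comm i z then 2 else 4).
Proof.
move=> sz zK a; rewrite /zstep; case: (boolP (comm i z)) => c; first exact: inv2_asc.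
have ss := simple_signed i; have szs := signed_wmul sz ss.
rewrite -inv2V; last exact: signed_wmul.
rewrite wmul_inv simpleV inv2_asc; first by rewrite inv2V // inv2_asc // -addnA.
  exact: signedV.
by rewrite wmul_inv simpleV involutiveV //; apply: noncomm_asc.
Qed.

(* 4 times the rank of 1 - z on R^n: with inv2 it makes up the rank function
   of the weak order on signed involutions. *)
Definition refl4 z : nat := \sum_x ((z x != x) + (z x == opp x)).

Lemma moved_weight i :
  \sum_(x | simple i x != x) (1 + (simple i x == opp x)) = 4.
Proof.
have gtE : \sum_(x | simple i x < x) (1 + (simple i x == opp x)) = 2 := simple_weight i.
rewrite (bigID (fun x => simple i x < x)) /=.
have -> : 4 = 2 + 2 by []; congr (_ + _); rewrite -[RHS]gtE.
  by apply: eq_bigl => x; rewrite -letter_eqE; case: ltngtP.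
rewrite [RHS](reindex_inj (@perm_inj _ (simple i))) /=; apply: eq_big => x.
  by rewrite simpleK -letter_eqE; case: ltngtP.
by rewrite simpleK [x == _]eq_sym (inv_eq (@oppK n)).
Qed.

Lemma refl4_zstep i z : signed z -> involutive z -> asc i z ->
  refl4 (zstep i z) = refl4 z + (if comm i z then 4 else 0).
Proof.
move=> sz zK a; rewrite /zstep /refl4; case: (boolP (comm i z)) => c; last first.
  rewrite addn0 (reindex_inj (@perm_inj _ (simple i))) /=; apply: eq_bigr => x _.
  by rewrite !wmulE simpleK -simple_signed !(inj_eq perm_inj).
rewrite -(moved_weight i) (big_mkcond (fun x => simple i x != x)) -big_split /=.
apply: eq_bigr => x _.
rewrite wmulE; have [->|m] /= := eqVneq (simple i x) x; first by rewrite addn0.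
rewrite (commP i z c); have [e|[e ne]] := asc_comm sz a c m.
  by rewrite e eqxx m [x == opp x]eq_sym (negPf (opp_neq x)).
rewrite ne e simple_signed simpleK opp_neq eqxx (inj_eq (@opp_inj n)) (negPf m).
by rewrite e in ne; rewrite (inv_eq (@oppK n)) in ne; rewrite (negPf ne).
Qed.

(** Both sides grow by 8 at each step: the left one by 2 * 2 + 4 if s commutes with z and by 2 * 4 +
    0 otherwise, the right one by 4 * 2. Hence the length of w depends on z only. *)
Lemma chain_inv2 z w f : chain z w f -> 2 * inv2 z + refl4 z = 4 * inv2 w.
Proof.
elim=> [|i z' w' f' ch IH a].
  by rewrite !inv2_1 /refl4 big1 // => x _; rewrite perm1 eqxx eq_sym (negPf (opp_neq x)).
have bl := chain_blocks ch; have sz := blocks_z bl; have zK := blocks_zK bl.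
rewrite inv2_zstep // refl4_zstep // inv2_asc; [|exact: blocks_w bl|].
  by case: ifP => _; move: IH; lia.
by have := @asc_word n i _ _ _ bl a (lo i); rewrite simple_lo; apply; apply: ltn_lo_hi.
Qed.

Lemma chain_step i z : signed z -> involutive z -> ~~ asc i z ->
  forall w f, chain (zstep i z) w f ->
  chain z (wmul w (simple i)) (fstep i (zstep i z) f).
Proof.
move=> sz zK d w f ch; rewrite -{1}(zstepK i z).
by apply: chain_cons => //; rewrite asc_zstep.
Qed.

Lemma inv2_zstep_desc i z : signed z -> involutive z -> ~~ asc i z ->
  inv2 (zstep i z) < inv2 z.
Proof.
move=> sz zK d; rewrite -{2}(zstepK i z) (@inv2_zstep i (zstep i z)) ?asc_zstep //.
- by case: ifP; lia.
- exact: signed_zstep.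
- exact: involutive_zstep.
Qed.

Lemma chain_ex z : signed z -> involutive z -> exists w f, chain z w f.
Proof.
have [m] := ubnP (inv2 z); elim: m z => // m IH z lt sz zK.
have [->|/eqP z1] := eqVneq z 1%g; first by exists 1%g, 1%g; exact: chain_nil.
have [i d] := desc_ex sz z1.
have [] := IH (zstep i z); [|exact: signed_zstep|exact: involutive_zstep|].
  by have := inv2_zstep_desc sz zK d; lia.
move=> w [f ch]; exists (wmul w (simple i)), (fstep i (zstep i z) f).
exact: chain_step.
Qed.

Variable dem : {perm (letter n)} -> {perm (letter n)} -> {perm (letter n)}.
Hypothesis dd : is_demazure dem.

Lemma dem11 : dem 1%g 1%g = 1%g :> {perm (letter n)}.
Proof.
have s1 := @signed1 n.
by rewrite (dem_reduced dd) ?/wmul ?mulg1 //; apply: double_inj; rewrite doubleD !lenE // inv2_1.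
Qed.

Lemma chain_dem z w f : chain z w f -> dem w^-1%g w = z.
Proof.
elim=> [|i z' w' f' ch IH a]; first by rewrite invg1 dem11.
have bl := chain_blocks ch.
rewrite dem_inv_step // ?IH; [|exact: blocks_w bl|].
  by rewrite dem_conj ?a //; [exact: blocks_z bl|exact: blocks_zK bl].
by have := @asc_word n i _ _ _ bl a (lo i); rewrite simple_lo; apply; apply: ltn_lo_hi.
Qed.

(* Letters of a reduced word of v which do not move the involution can be
   dropped. *)
Lemma chain_shorten v : signed v ->
  exists w f, chain (dem v^-1%g v) w f /\ (inv2 w < inv2 v \/ w = v).
Proof.
move: v; apply: signed_ind => [|i v sv a [w [f [ch h]]]].
  by exists 1%g, 1%g; rewrite invg1 dem11; split; [exact: chain_nil|right].
have bl := chain_blocks ch.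
rewrite dem_inv_step // dem_conj //; [|exact: blocks_z bl|exact: blocks_zK bl].
rewrite (inv2_asc sv a); case: ifP => az.
  exists (wmul w (simple i)), (fstep i (dem v^-1%g v) f); split; first exact: chain_cons.
  case: h => [lt|->]; [left|by right].
  rewrite inv2_asc; [lia|exact: blocks_w bl|].
  by have := @asc_word n i _ _ _ bl az (lo i); rewrite simple_lo; apply; apply: ltn_lo_hi.
exists w, f; split=> //; left; case: h => [|->]; lia.
Qed.

(** Any v with product z shortens to a chain, and all chains to z have equal length: a minimal v is
    spelled by a chain, and no v is shorter than one. *)
Lemma atomsP z w : atoms dem z w <-> exists f, chain z w f.
Proof.
split=> [[sw e min]|[f ch]].
  have [w' [f [ch [lt|<-]]]] := chain_shorten sw; rewrite e in ch; last by exists f.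
  have sw' := blocks_w (chain_blocks ch).
  have := min _ sw' (chain_dem ch); rewrite -leq_double !lenE //; lia.
have sw := blocks_w (chain_blocks ch); split; [by []|exact: chain_dem ch|].
move=> v sv e; have [w' [f' [ch' h]]] := chain_shorten sv; rewrite e in ch'.
rewrite -leq_double !lenE //.
have := chain_inv2 ch; rewrite (chain_inv2 ch'); case: h => [|->]; lia.
Qed.

End Atoms.

(** * Deletion of descents and shapes *)

Section Shapes.
Variable n : nat.
Implicit Types (x y b : letter n) (s l r : seq (letter n)) (z w f : {perm (letter n)}).

Lemma first_descent_some s b x s' : first_descent s = Some ((b, x), s') ->
  exists l r, [/\ s = l ++ b :: x :: r, s' = l ++ r & x < b].
Proof.
elim: s s' => [//|y s IH] s' /=; case: s IH => [//|y' s] IH.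
case: ltnP => [lt [<- <- <-]|_]; first by exists [::], s.
case E: first_descent => [[[b' x'] s1]|] //= [eb ex <-].
rewrite eb ex in E; have [l [r [-> -> lt]]] := IH _ E.
by exists (y :: l), r.
Qed.

Lemma first_descent_none s : first_descent s = None -> sorted (fun x y => x <= y) s.
Proof.
elim: s => [//|y s IH] /=; case: s IH => [//|y' s] IH.
by case: ltnP => // le; case E: first_descent => //= _; rewrite le; apply: IH.
Qed.

Lemma pairwise_rel2 (T : eqType) (r1 r2 : rel T) (s : seq T) : pairwise r1 s -> pairwise r2 s ->
  (forall x y : T, r1 x y -> r1 y x -> False) ->
  forall x y : T, x \in s -> y \in s -> r1 x y -> r2 x y.
Proof.
move=> + + as1; elim: s => //= t s IH /andP[a1 p1] /andP[a2 p2] x y.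
rewrite !inE => /orP[/eqP->|xs] /orP[/eqP->|ys] h.
- by case: (as1 t t).
- exact: (allP a2).
- by case: (as1 x t) => //; apply: (allP a1).
- exact: IH.
Qed.

Section Blocks.
Variables (z w f : {perm (letter n)}).
Hypothesis bl : blocks z w f.
Let fK := blocks_fK bl.

(** What remains of the word after some deletions. Closure under f records that pairs disappear as a
    whole. *)
Definition subword s : Prop :=
  [/\ pairwise (fun x y => w x < w y) s, forall x, x \in s -> positive (w x)
    & forall x, x \in s -> f x \in s].

Lemma blocks_upper x : positive (w x) -> f x < x -> w x < w (f x).
Proof.
move=> px lt; have := blocks_order bl (blocks_word bl px); rewrite fK.
have : w x != w (f x) by rewrite (inj_eq perm_inj) -letter_eqE; lia.
by case/letter_neq_lt/orP => // lt' /(_ lt')[]; lia.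
Qed.

(** Suppose f b <> x. By [blocks_apart], f b < f x. As b and x are consecutive, every other letter
    stands before b or after x; so if x < f x, then f x precedes b, and [blocks_between] forbids b <
    f x. Each position of f b relative to b then contradicts this or the clauses for b. *)
Lemma subword_descent l b x r : subword (l ++ b :: x :: r) -> x < b -> f b = x.
Proof.
case; rewrite pairwise_cat /= !allrel_consr => /and3P[/and3P[lb lx lr] _].
move=> /and3P[/andP[lbx ab] ax _] pos clo ltxb.
have bs : b \in l ++ b :: x :: r by rewrite mem_cat !inE eqxx orbT.
have xs : x \in l ++ b :: x :: r by rewrite mem_cat !inE eqxx !orbT.
have pb := pos _ bs; have px := pos _ xs.
have dich u : u \in l ++ b :: x :: r -> u != b -> u != x -> w u < w b \/ w x < w u.
  rewrite mem_cat !inE => /or4P[ul|/eqP->|/eqP->|ur]; rewrite ?eqxx //.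
    by left; apply: (allP lb).
  by right; apply: (allP ax).
apply/eqP/negPn/negP => ne.
have nefx : f x != b by apply: contra ne => /eqP<-; rewrite fK.
have ltf : f b < f x.
  have : f b != f x by rewrite (inj_eq perm_inj) gtn_neq.
  case/letter_neq_lt/orP => // lt.
  by have [lt'] := blocks_apart bl px pb ltxb lt; have := ltn_trans lt' lbx; rewrite ltnn.
have fxs := clo _ xs; have fbs := clo _ bs.
have pfx := pos _ fxs.
have up : x < f x -> w (f x) < w b /\ ~ (x < b /\ b < f x).
  move=> lt; have ltw := blocks_upper pfx; rewrite fK in ltw.
  have ltb : w (f x) < w b.
    have [//|lt'] := dich _ fxs nefx (gtn_neq lt).
    by have := ltn_trans lt' (ltw lt); rewrite ltnn.
  by split=> //; have := blocks_between bl pfx ltb; rewrite fK; apply.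
have [e|] := eqVneq (f b) b.
  rewrite e in ltf; have [_ nb] := up (ltn_trans ltxb ltf).
  by apply: nb.
case/letter_neq_lt/orP => lt.
  have ltw := blocks_upper pb lt.
  have ltxf : w x < w (f b).
    have [lt'|//] := dich _ fbs (ltn_neq lt) ne.
    by have := ltn_trans lt' ltw; rewrite ltnn.
  have nb := blocks_between bl pb lbx ltxf.
  have le : x < f b.
    rewrite ltnNge leq_eqVlt negb_or letter_eqE ne /=; apply/negP => h.
    by apply: nb.
  have [_ nb'] := up (ltn_trans le ltf).
  have ltfx : f x < b.
    rewrite ltnNge leq_eqVlt negb_or letter_eqE eq_sym nefx /=.
    by apply/negP => h; apply: nb'.
  have [//|_] := blocks_apart bl px (pos _ fbs) le; first by rewrite fK.
  by rewrite fK ltnNge ltnW.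
have ltbx : b < f x := ltn_trans lt ltf.
have [_ nb] := up (ltn_trans ltxb ltbx).
by apply: nb.
Qed.

Lemma subword_delete l b x r : subword (l ++ b :: x :: r) -> f b = x ->
  subword (l ++ r).
Proof.
case=> pw pos clo fb; have fx : f x = b by rewrite -fb fK.
move: (pw); rewrite pairwise_cat /= !allrel_consr => /and3P[/and3P[lb lx lr] pl].
move=> /and3P[/andP[lbx ab] ax pr].
have notin y : y \in l ++ r -> y != b /\ y != x.
  rewrite mem_cat => /orP[yl|yr].
    have := allP lb _ yl; have := allP lx _ yl => /= h1 h2.
    by split; apply/eqP => e; move: h1 h2; rewrite e ltnn.
  have := allP ab _ yr; have := allP ax _ yr => /= h1 h2.
  by split; apply/eqP => e; move: h1 h2; rewrite e ltnn.
have sub y : y \in l ++ r -> y \in l ++ b :: x :: r.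
  by rewrite !mem_cat !inE => /orP[->//|->]; rewrite !orbT.
split; first by rewrite pairwise_cat lr pl.
  by move=> y /sub/pos.
move=> y yin; have := clo _ (sub _ yin); have [nb nx] := notin _ yin.
rewrite !mem_cat !inE; have -> : (f y == b) = false.
  by apply: contraNF nx => /eqP e; rewrite -fb -e fK.
have -> // : (f y == x) = false.
by apply: contraNF nb => /eqP e; rewrite -fx -e fK.
Qed.

(** Once no descent is left the word increases, whereas [blocks_order] puts the larger letter of a
    pair first; so f fixes all remaining letters. *)
Lemma delete_descentsP k s (d := delete_descents k s) : subword s -> size s <= k ->
  (forall p, (p \in d.1) = [&& p.1 \in s, p.2 == f p.1 & w p.1 < w p.2]) /\
  (forall x, (x \in d.2) = (x \in s) && (f x == x)).
Proof.
rewrite /d {d}; elim: k s => [|k IH] s sub; first by case: s sub.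
move=> le /=; case E: first_descent => [[[b x] s']|] /=; last first.
  have le2 : pairwise (fun x y => x <= y) s.
    rewrite -sorted_pairwise; first exact: first_descent_none.
    by move=> y x t; apply: leq_trans.
  have [pw pos clo] := sub.
  have fixed x : x \in s -> f x = x.
    have main y : y \in s -> w y < w (f y) -> False.
      move=> ys lt; have [lt' _] := blocks_order bl (pos _ ys) lt.
      have as1 (u v : letter n) : w u < w v -> w v < w u -> False by lia.
      by have := pairwise_rel2 pw le2 as1 ys (clo _ ys) lt; rewrite leqNgt lt'.
    move=> xs; apply/eqP/negPn/negP => ne.
    have : w x != w (f x) by rewrite (inj_eq perm_inj) eq_sym.
    case/letter_neq_lt/orP => lt; first exact: (main x).
    by apply: (main (f x)); rewrite ?clo // fK.
  split=> [p|x]; last first.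
    by case xs : (x \in s); rewrite // fixed // eqxx.
  rewrite in_nil; apply/esym/negP => /and3P[ps /eqP e].
  by rewrite e fixed // ltnn.
have [l [r [es es' lt]]] := first_descent_some E; subst s s'.
have fb := subword_descent sub lt; have sub' := subword_delete sub fb.
have fx : f x = b by rewrite -fb fK.
have [pos_lt _ _] := sub; move: pos_lt.
rewrite pairwise_cat /= => /and3P[_ _ /andP[/andP[ltbx _] _]].
have [|IH1 IH2] := IH _ sub'; first by move: le; rewrite !size_cat /=; lia.
split=> [[p q]|y].
  rewrite inE IH1 /= !mem_cat !inE xpair_eqE.
  have [->|nb] := eqVneq p b.
    rewrite fb /=; have [->|_] /= := eqVneq q x; first by rewrite ltbx !orbT.
    by rewrite !andbF.
  have [->|nx] := eqVneq p x; last by [].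
  rewrite fx /=; have [->|_] /= := eqVneq q b; last by rewrite !andbF.
  have -> : (w x < w b) = false by rewrite ltnNge ltnW.
  by rewrite !andbF.
rewrite IH2 !mem_cat !inE.
have [->|nb] := eqVneq y b.
  by rewrite fb (negPf (ltn_neq lt)) !andbF.
have [->|nx] := eqVneq y x; last by [].
by rewrite fx (negPf (gtn_neq lt)) !andbF.
Qed.

Lemma mem_one_line x : (x \in one_line w^-1%g) = positive (w x).
Proof.
apply/mapP/idP => [[i _ ->]|px]; first by rewrite permKV positive_pos.
have hi : w x - n < n by have := ltn_ord (w x); move: px; rewrite /positive; lia.
exists (Ordinal hi); first by rewrite mem_enum.
apply: (@perm_inj _ w); rewrite permKV; apply/ord_inj => /=.
by move: px; rewrite /positive; lia.
Qed.

Lemma subword_one_line : subword (one_line w^-1%g).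
Proof.
split=> [|x|x]; rewrite ?mem_one_line //; last exact: (blocks_word bl).
rewrite /one_line pairwise_map; apply: (@sub_pairwise _ (relpre val ltn)).
  by move=> i j /=; rewrite !permKV /= ltn_add2l.
by rewrite -pairwise_map val_enum_ord -sorted_pairwise ?iota_ltn_sorted //; apply: ltn_trans.
Qed.

Lemma size_one_line : size (one_line w^-1%g) = n.
Proof. by rewrite size_map -cardT card_ord. Qed.

Lemma mem_NDes p :
  (p \in NDes w^-1%g) = [&& positive (w p.1), p.2 == f p.1 & w p.1 < w p.2].
Proof.
have [-> _] := delete_descentsP subword_one_line (eq_leq size_one_line).
by rewrite mem_one_line.
Qed.

Lemma mem_xi x : (x \in xi w^-1%g) = positive (w x) && (f x == x).
Proof.
have [_ ->] := delete_descentsP subword_one_line (eq_leq size_one_line).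
by rewrite mem_one_line.
Qed.

Definition shape_block x : {set letter n} := [set x; opp (f x)]%SET.

Lemma shape_block_opp x : shape_block (opp (f x)) = shape_block x.
Proof. by rewrite /shape_block (blocks_f bl) fK oppK finset.setUC. Qed.

(** Indexing by single letters absorbs the three kinds of blocks: x and - f x give the same block,
    and f x = x gives {x, - x}. *)
Lemma mem_sh (A : {set letter n}) :
  A \in sh w^-1%g <-> exists x, z x = opp x /\ A = shape_block x.
Proof.
have sf := blocks_f bl; have sz := blocks_z bl.
have pairP p : p \in sh_pairs w^-1%g ->
    [/\ z p.1 = opp p.1 & p.2 = f p.1].
  rewrite mem_filter => /andP[/and3P[p1 n2 lt]]; rewrite mem_NDes.
  move=> /and3P[pw /eqP e _]; split=> //.
  by rewrite (blocks_max_lt bl pw) // -e ltn_oppr.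
split.
  rewrite /sh !finset.in_setU => /orP[/orP[]|] /finset.imsetP[p].
  - by move=> /pairP[e1 e2] ->; exists p.1; rewrite /shape_block -e2.
  - move=> /pairP[e1 e2] ->; exists (opp p.1).
    by rewrite /shape_block sz e1 sf !oppK -e2.
  - rewrite mem_filter mem_xi => /and3P[np pw /eqP e] ->; exists p.
    split; last by rewrite /shape_block e finset.setUC.
    apply: (blocks_max_lt bl pw); rewrite e.
    by move: np; rewrite negativeE -positive_opp positiveE oppK.
move=> [x [ex ->]].
have main y : positive (w y) -> z y = opp y ->
    shape_block y \in sh w^-1%g /\ shape_block (opp y) \in sh w^-1%g.
  move=> py ey; have ltf : f y < opp y.
    have [//|gt] := orP (letter_neq_lt (blocks_neq_opp bl py)).
    have e := blocks_max_gt bl py gt; rewrite ey in e.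
    by have := blocks_neq_opp bl py; rewrite -e eqxx.
  have [e|ne] := eqVneq (f y) y.
    have ny : negative y by rewrite negativeE -positive_opp positiveE oppK -{1}e.
    have yin : [set opp y; y]%SET \in sh w^-1%g.
      rewrite /sh !finset.in_setU; apply/orP; right; apply/finset.imsetP; exists y => //.
      by rewrite mem_filter ny mem_xi py e eqxx.
    by rewrite /shape_block sf e oppK finset.setUC.
  have upper u : positive (w u) -> w u < w (f u) -> f u < opp u -> 
      shape_block u \in sh w^-1%g /\ shape_block (opp u) \in sh w^-1%g.
    move=> pu lt ltu; have [_ posu] := blocks_order bl pu lt.
    have pin : (u, f u) \in sh_pairs w^-1%g.
      rewrite mem_filter mem_NDes /= posu pu eqxx lt ltn_oppr ltu !andbT /=.
      have : ~~ positive (opp u) by rewrite positive_opp posu.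
      by rewrite /negative /positive; lia.
    rewrite /shape_block sf oppK /sh !finset.in_setU; split.
      by apply/orP; left; apply/orP; left; apply/finset.imsetP; exists (u, f u).
    by apply/orP; left; apply/orP; right; apply/finset.imsetP; exists (u, f u).
  have : w y != w (f y) by rewrite (inj_eq perm_inj) eq_sym.
  case/letter_neq_lt/orP => lt; first exact: upper.
  have := upper (f y) (blocks_word bl py); rewrite fK ltn_oppr => /(_ lt ltf)[h1 h2].
  rewrite -(shape_block_opp y) -(shape_block_opp (opp y)) sf oppK.
  by split.
have [px|nx] := boolP (positive (w x)); first by have [] := main x px ex.
have := main (opp x); rewrite (word_opp bl) nx sz ex => /(_ isT erefl)[_].
by rewrite oppK.
Qed.

End Blocks.
End Shapes.

(** * Action on clans *)

Section Clans.
Variable n : nat.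
Implicit Types (x y : letter n) (z w f : {perm (letter n)}) (i : 'I_n) (c : skew_clan n).

Definition clan_neg c : {perm (letter n)} := wopp (clan_iota c).

Lemma clan_iotaE c x : clan_iota c x = if c x is inl y then y else x.
Proof. by rewrite permE. Qed.

Lemma clan_iotaK c : involutive (clan_iota c).
Proof.
move=> x; rewrite !clan_iotaE; case E: (c x) => [y|b]; last by rewrite E.
by have [_ ->] := entry_mate E.
Qed.

Lemma signed_clan_iota c : signed (clan_iota c).
Proof. by move=> x; rewrite !clan_iotaE entry_skew; case: (c x). Qed.

Lemma signed_clan_neg c : signed (clan_neg c).
Proof. by move=> x; rewrite !woppE signed_clan_iota. Qed.

Lemma clan_negK c : involutive (clan_neg c).
Proof. by move=> x; rewrite !woppE signed_clan_iota clan_iotaK oppK. Qed.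

Lemma is_signE c x : is_sign (c x) = (clan_iota c x == x).
Proof.
rewrite clan_iotaE; case E: (c x) => [y|b]; last by rewrite eqxx.
by have [/negPf-> _] := entry_mate E.
Qed.

Lemma is_sign_neg c x : is_sign (c x) = (clan_neg c x == opp x).
Proof. by rewrite is_signE woppE (inj_eq (@opp_inj n)). Qed.

Lemma signP c x b : c x = inr b -> clan_iota c x = x.
Proof. by rewrite clan_iotaE => ->. Qed.

Lemma sign_opp c x b : c x = inr b -> c (opp x) = inr (~~ b).
Proof. by rewrite entry_skew => ->. Qed.

Lemma sign_ex c x : clan_iota c x = x -> exists b, c x = inr b.
Proof. by move/eqP; rewrite -is_signE; case: (c x) => // b _; exists b. Qed.

Lemma asc_clan_neg i c : asc i (clan_neg c) = ~~ asc i (clan_iota c).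
Proof.
rewrite /asc !woppE ltn_opp -leqNgt [RHS]leq_eqVlt letter_eqE (inj_eq perm_inj).
by rewrite (negPf (gtn_neq (ltn_lo_hi i))).
Qed.

Lemma comm_wopp i z : comm i (wopp z) = comm i z.
Proof.
apply/commP/commP => e x; last by rewrite !woppE e simple_signed.
by apply: opp_inj; rewrite -simple_signed -!woppE e.
Qed.

Lemma zstep_wopp i z : zstep i (wopp z) = wopp (zstep i z).
Proof.
apply/permP => x; rewrite /zstep comm_wopp; case: ifP => _.
  by rewrite !(wmulE, woppE).
by rewrite !(wmulE, woppE) simple_signed.
Qed.

(** The balance of signs is automatic, as negation of positions exchanges + and -. *)
Lemma clan_ex (y : {perm (letter n)}) (sg : letter n -> bool) :
  involutive y -> signed y -> (forall x, y x = x -> sg (opp x) = ~~ sg x) ->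
  exists c, (forall x, c x = if y x == x then inr (sg x) else inl (y x)) /\
            clan_iota c = y.
Proof.
move=> yK sy sgN.
pose e := [ffun x => if y x == x then inr (sg x) else inl (y x)] : {ffun letter n -> symbol n}.
have mate x t : e x = inl t -> t != x /\ e t = inl x.
  by rewrite !ffunE; case: eqVneq => // ne [<-]; rewrite yK [x == _]eq_sym (negPf ne).
have skew x : e (opp x) = match e x with inl t => inl (opp t) | inr b => inr (~~ b) end.
  rewrite !ffunE sy (inj_eq (@opp_inj n)); case: eqVneq => // ex.
  by rewrite sgN.
have bal : #|[pred x | e x == inr true]| = #|[pred x | e x == inr false]|.
  rewrite -!sum1_card (reindex_inj (@opp_inj n)) /=; apply: eq_bigl => x.
  by rewrite !inE skew; case: (e x) => // -[].
exists (SkewClan mate bal skew); split=> [x|]; first by rewrite /= ffunE.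
by apply/permP => x; rewrite clan_iotaE /= ffunE; case: eqP.
Qed.

Definition sgn_of c x : bool := if c x is inr b then b else false.

Lemma signsE c : signs c = [seq sgn_of c x | x <- enum (letter n) & is_sign (c x)].
Proof.
rewrite /signs /sgn_of; elim: (enum _) => //= x s ->.
by case E: (c x) => //=; rewrite E.
Qed.

Lemma enum_letter_sorted : sorted (fun x y => x < y) (enum (letter n)).
Proof. by have := iota_ltn_sorted 0 (n + n); rewrite -val_enum_ord sorted_map. Qed.

(** Two positions exchanged by s cannot both carry signs, for s would then commute with iota; hence
    s moves the signs without changing their order. *)
Lemma signs_simple i c c' : ~~ comm i (clan_iota c) ->
  (forall x b, c' x = inr b <-> c (simple i x) = inr b) -> signs c' = signs c.
Proof.
move=> nc e; set s := simple i; have sK : involutive s by exact: simpleK.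
have sgE x : is_sign (c' x) = is_sign (c (s x)) /\
    (is_sign (c' x) -> sgn_of c' x = sgn_of c (s x)).
  rewrite /sgn_of; case E: (c (s x)) => [t|b]; last by rewrite (iffRL (e x b) E).
  by case E': (c' x) => [t'|b]; rewrite // (iffLR (e x b) E') in E.
rewrite !signsE; have -> : [seq sgn_of c' x | x <- enum (letter n) & is_sign (c' x)] =
    [seq sgn_of c x | x <- [seq s x | x <- enum (letter n) & is_sign (c' x)]].
  rewrite -map_comp; apply/eq_in_map => x; rewrite mem_filter => /andP[h _].
  by rewrite (sgE x).2.
congr map; apply: (@irr_sorted_eq _ (fun x y => x < y)).
- by move=> y x t; apply: ltn_trans.
- by move=> x; rewrite ltnn.
- rewrite sorted_pairwise; last by move=> y x t; apply: ltn_trans.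
  rewrite pairwise_map; have := enum_letter_sorted.
  rewrite sorted_pairwise; last by move=> y x t; apply: ltn_trans.
  move=> /(pairwise_filter (fun x => is_sign (c' x))).
  set F := filter _ _.
  have FP x : x \in F -> is_sign (c (s x)) by rewrite mem_filter => /andP[]; rewrite (sgE x).1.
  elim: F FP => //= x F IH FP /andP[a p]; rewrite IH ?andbT //; last first.
    by move=> y yF; apply: FP; rewrite inE yF orbT.
  apply/allP => y yF; have lt := allP a _ yF; have [//|ey] := simple_lt i lt.
  have := FP y; rewrite inE yF orbT ey -/s sK is_signE => /(_ isT)/eqP h1.
  have := FP x; rewrite inE eqxx is_signE => /(_ isT)/eqP h2.
  case/negP: nc; apply: (@comm_moved n i _ x); rewrite -/s ?h1 ?h2 //.
    exact: signed_clan_iota.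
  by rewrite -ey; apply: gtn_neq.
- by apply: sorted_filter enum_letter_sorted => y x t; apply: ltn_trans.
- move=> x; rewrite mem_filter mem_enum andbT; apply/mapP/idP => [[y]|h].
    by rewrite mem_filter => /andP[+ _] ->; rewrite (sgE y).1.
  by exists (s x); rewrite ?sK // mem_filter mem_enum (sgE _).1 sK h.
Qed.

(** A proper edge from c to c' = t_i . c, seen through z = - iota(c). If s commutes with z, the
    signs at moved positions, if any, are opposite and disappear; otherwise all signs travel along
    s. *)
Definition step_rel i c c' : Prop :=
  [/\ ~~ asc i (clan_neg c), clan_neg c' = zstep i (clan_neg c) &
    if comm i (clan_neg c) then
      (forall x b, c' x = inr b <-> c x = inr b /\ simple i x = x) /\
      (forall x b, c x = inr b -> simple i x != x -> c (simple i x) = inr (~~ b))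
    else (forall x b, c' x = inr b <-> c (simple i x) = inr b) /\ signs c' = signs c].

Definition equal_signs i c : Prop :=
  i != 0 :> nat /\ exists b, c (lo i) = inr b /\ c (pos i) = inr b.

Variable dem : {perm (letter n)} -> {perm (letter n)} -> {perm (letter n)}.
Hypothesis dd : is_demazure dem.

Lemma clan_act_dem i c c' : ~ (is_sign (c (lo i)) /\ is_sign (c (pos i))) ->
  demazure_conj dem (simple i) c c' -> clan_act dem i c c'.
Proof.
rewrite /clan_act /lo; case: ifP => i0.
  rewrite /neg entry_skew => h; rewrite ifF //.
  by apply/negP => h2; apply: h; split => //; case: (c (pos i)) h2.
move=> h; rewrite ifF //; apply/negP => /andP[h1 h2]; exact: h.
Qed.

Lemma comm_fixed i z x t : signed z -> comm i z ->
  simple i x != x -> simple i t != t -> z x = x -> z t = t.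
Proof.
by move=> sz /commP e mx mt ex; have [] := simple_moved2 mx mt => ->; rewrite ?sz ?e ?ex.
Qed.

Lemma signs_eq c c' : (forall x b, c' x = inr b <-> c x = inr b) -> signs c' = signs c.
Proof.
move=> e; apply: eq_pmap => x.
case E: (c x) => [t|b]; last by rewrite (iffRL (e x b) E).
by case E': (c' x) => [t'|b] //; rewrite (iffLR (e x b) E') in E.
Qed.

(** Besides an ascent of z, equal signs at i and i + 1 are the only reason for t_i to fix c. *)
Lemma clan_step i c : exists c', clan_act dem i c c' /\
  (step_rel i c c' \/ c' = c /\ (asc i (clan_neg c) \/ equal_signs i c)).
Proof.
set y := clan_iota c.
have sy : signed y := signed_clan_iota c.
have yK : involutive y := @clan_iotaK c.
have hne : simple i (lo i) != lo i by rewrite simple_lo gtn_neq // ltn_lo_hi.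
rewrite /step_rel asc_clan_neg negbK zstep_wopp comm_wopp -/y.
have dy := dem_conj dd i sy yK.
have both : is_sign (c (lo i)) /\ is_sign (c (pos i)) -> comm i y /\ asc i y.
  rewrite !is_signE -/y => -[/eqP h1 /eqP h2]; rewrite /asc h1 h2 ltn_lo_hi; split=> //.
  by apply: (@comm_moved n i y (lo i) sy hne); rewrite simple_lo h2 h1 simple_lo.
have [a|na] := boolP (asc i y); last first.
  exists c; split; last by right; split=> //; left.
  apply: clan_act_dem => [/both[_]|]; first by apply/negP.
  by split; rewrite // dy (negPf na).
rewrite a in dy.
have [cm|nc] := boolP (comm i y); last first.
  pose sg x := sgn_of c (simple i x).
  have [x /eqP|c' [e' io]] := @clan_ex (zstep i y) sg (involutive_zstep i yK) (signed_zstep i sy) _.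
    rewrite /zstep (negPf nc) !wmulE (inv_eq (simpleK i)) => /eqP/sign_ex[b e].
    by rewrite /sg /sgn_of simple_signed (sign_opp e) e.
  have ee x b : c' x = inr b <-> c (simple i x) = inr b.
    rewrite e' /zstep (negPf nc) !wmulE (inv_eq (simpleK i)) -is_signE /sg /sgn_of.
    by case: (c (simple i x)) => //.
  have es := signs_simple nc ee.
  exists c'; split; last by left; rewrite -io.
  apply: clan_act_dem => [/both[]|]; first by rewrite (negPf nc).
  by split; rewrite // dy.
pose sg := sgn_of c.
have mv x : simple i x != x -> y (simple i x) != x.
  move=> m; rewrite (commP i y cm); have [->//|[-> _]] := asc_comm sy a cm m.
  by rewrite simple_signed simpleK opp_neq.
have [x /eqP|c' [e' io]] := @clan_ex (zstep i y) sg (involutive_zstep i yK) (signed_zstep i sy) _.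
  rewrite /zstep cm !wmulE; have [->|/mv/negPf->//] := eqVneq (simple i x) x.
  by move=> /eqP/sign_ex[b e]; rewrite /sg /sgn_of (sign_opp e) e.
have ee x b : c' x = inr b <-> c x = inr b /\ simple i x = x.
  rewrite e' /zstep cm !wmulE; have [->|m] := eqVneq (simple i x) x; last first.
    by rewrite (negPf (mv _ m)); split=> // -[_ h]; rewrite h eqxx in m.
  by rewrite -is_signE /sg /sgn_of; case: (c x) => //= b'; split=> [//|[]].
have hne' : simple i (pos i) != pos i by rewrite simple_hi ltn_neq // ltn_lo_hi.
have [/andP[]|nb] := boolP (is_sign (c (lo i)) && is_sign (c (pos i))); last first.
  (* As s commutes with iota, a sign at one moved position would put signs at all of them. *)
  have nsg x b : c x = inr b -> simple i x = x.
    move=> e; apply/eqP/negPn/negP => m; case/negP: nb; rewrite !is_signE -/y.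
    by rewrite !(comm_fixed sy cm m _ (signP e)) ?eqxx.
  have es : signs c' = signs c.
    by apply: signs_eq => x b; rewrite ee; split=> [[]//|e]; split=> //; apply: nsg e.
  exists c'; split; last first.
    by left; rewrite -io; split=> //; split=> // x b e; rewrite (nsg _ _ e) eqxx.
  apply: clan_act_dem; first by move=> /andP; apply/negP.
  by split; rewrite // dy.
case E1: (c (lo i)) => [//|b1] _; case E2: (c (pos i)) => [//|b2] _.
have [/andP[i0 /eqP e12]|n12] := boolP ((i != 0 :> nat) && (b1 == b2)).
  exists c; split; last by right; split=> //; right; split=> //; exists b1; rewrite E1 E2 e12.
  rewrite /clan_act (negPf i0); move: E1; rewrite /lo (negPf i0) => E1.
  by rewrite E1 E2 e12 eqxx.
(* For t_0 skew-symmetry makes the signs at -1 and 1 opposite. *)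
have eb : b2 = ~~ b1.
  have [i0|i0] := eqVneq (i : nat) 0.
    by move: (sign_opp E1); rewrite opp_lo0 // E2 => -[].
  by move: n12; rewrite i0 /=; case: b1 b2 {E1 E2} => -[].
have al x b : c x = inr b -> simple i x != x -> c (simple i x) = inr (~~ b).
  have eb' : b1 = ~~ b2 by rewrite eb negbK.
  move=> + /simple_moved[] ex; rewrite ex ?simple_signed ?simple_lo ?simple_hi.
  - by rewrite E1 E2 eb => -[->].
  - by rewrite E1 E2 eb' => -[->].
  - by rewrite (sign_opp E1) (sign_opp E2) eb => -[->].
  - by rewrite (sign_opp E1) (sign_opp E2) eb' => -[->].
exists c'; split; last by left; rewrite -io.
have pu : pair_up (simple i) c c'.
  move=> x; rewrite e' /zstep cm !wmulE; have [ex|m] := eqVneq (simple i x) x.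
    rewrite ex -is_signE /sg /sgn_of; case E: (c x) => [t|//] /=.
    by rewrite clan_iotaE E.
  rewrite (negPf (mv _ m)) (commP i y cm); congr (inl (simple i _)).
  by apply: (comm_fixed sy cm hne m); apply: signP E1.
rewrite /clan_act; have [i0|i0] := eqVneq (i : nat) 0; first by rewrite E2.
rewrite /lo (negPf i0) in E1; rewrite E1 E2 /= ifF //.
by apply/eqP => -[e12]; move: n12; rewrite i0 e12 eqxx.
Qed.

End Clans.

(** * Counting negative letters and drops *)

Section Counting.
Variable n : nat.
Implicit Types (x y : letter n) (z w f : {perm (letter n)}) (i : 'I_n).

Definition drops z : nat := #|[pred x : letter n | positive x && (z x < x)]|.

Lemma dropsE z : drops z = \sum_(x | positive x) (z x < x).
Proof. by rewrite /drops -sum1_card big_mkcondr; apply: eq_bigr => x _; case: ltnP. Qed.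

Lemma ell0E w : ell0 w = \sum_(x | positive x) negative (w x).
Proof.
rewrite big_mkcond big_split_ord /= big1 ?add0n => [|j _]; last first.
  by rewrite /positive /= leqNgt ltn_ord.
rewrite /ell0 -sum1_card big_mkcond; apply: eq_bigr => j _.
by rewrite inE (positive_pos j : positive (rshift n j)); case: (negative _).
Qed.

Lemma positive_simple i x : i != 0 :> nat -> positive (simple i x) = positive x.
Proof.
move=> i0; have [//|ne] := eqVneq (positive (simple i x)) (positive x).
by rewrite eq_sym in ne; have /simple_oppE/eqP := simple_cross ne; rewrite (negPf i0).
Qed.

Lemma simple_unmoved0 i x : i = 0 :> nat -> positive x -> x != pos i -> simple i x = x.
Proof.
move=> i0 px ne; apply/eqP/negPn/negP => m.
have [] := simple_moved m => ex; move: px ne; rewrite ex ?eqxx //.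
- by rewrite /lo i0 /neg positive_opp positive_pos.
- by rewrite opp_lo0 ?eqxx.
- by rewrite positive_opp positive_pos.
Qed.

Lemma ell0_asc i w : signed w -> asc i w ->
  ell0 (wmul w (simple i)) = ell0 w + (i == 0 :> nat).
Proof.
move=> sw a; rewrite !ell0E; have [i0|i0] := eqVneq (i : nat) 0; last first.
  rewrite (reindex_inj (@perm_inj _ (simple i))) addn0.
  by apply: eq_big => [x|x _]; rewrite ?positive_simple // wmulE simpleK.
rewrite (bigD1 (pos i)) ?positive_pos //= [in RHS](bigD1 (pos i)) ?positive_pos //=.
rewrite wmulE simple_hi.
have plo : lo i = opp (pos i) by rewrite -opp_lo0 // oppK.
move: a; rewrite /asc plo sw -positiveE !negativeE positive_opp => -> /=.
rewrite add0n addnC; congr (_ + _); apply: eq_bigr => x /andP[px ne].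
by rewrite wmulE simple_unmoved0.
Qed.

Lemma unmoved_ltE i x y : simple i x = x -> (simple i y < x) = (y < x).
Proof.
move=> ex; apply/idP/idP => lt; have [] := simple_lt i lt; rewrite ?simpleK ?ex //.
  by move=> e; move: lt; rewrite -e ex ltnn.
by move=> e; move: lt; rewrite -(simpleK i y) -e ex ltnn.
Qed.

(** At t_0 the ascent means z(1) > 0, and the step makes 1 a drop. A merging turns two fixed points
    into a 2-cycle, with a drop at i + 1. In the other cases x -> s x matches the drops before and
    after. *)
Lemma drops_zstep i z : signed z -> involutive z -> asc i z ->
  drops (zstep i z) = drops z + ((i == 0 :> nat) || merging i z).
Proof.
move=> sz zK a; have d : ~~ asc i (zstep i z) by rewrite asc_zstep // a.
have sz' := signed_zstep i sz.
rewrite !dropsE; have [i0|i0] := eqVneq (i : nat) 0.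
  have plo : lo i = opp (pos i) by rewrite -opp_lo0 // oppK.
  have hn : pos i = n :> nat by rewrite /= i0 addn0.
  rewrite (bigD1 (pos i)) ?positive_pos //= [in RHS](bigD1 (pos i)) ?positive_pos //=.
  have -> : (zstep i z (pos i) < pos i) = true.
    by move: d; rewrite /asc plo sz' -positiveE /positive hn -ltnNge => ->.
  have -> : (z (pos i) < pos i) = false.
    by move: a; rewrite /asc plo sz -positiveE /positive hn ltnNge => ->.
  rewrite add0n addnC; congr (_ + _); apply: eq_bigr => x /andP[px ne].
  have ex := simple_unmoved0 i0 px ne.
  rewrite /zstep; case: ifP => _; rewrite !wmulE ex //.
  by rewrite unmoved_ltE.
rewrite (reindex_inj (@perm_inj _ (simple i))) /=.
under eq_bigl => x do rewrite positive_simple //.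
have zE x : zstep i z (simple i x) = if comm i z then z x else simple i (z x).
  by rewrite /zstep; case: ifP => _; rewrite !wmulE simpleK.
under eq_bigr => x _ do rewrite zE.
case: (boolP (comm i z)) => c; last first.
  have nm : ~~ merging i z.
    apply: contra c => /and3P[_ /eqP e1 /eqP e2].
    by apply: (@comm_moved n i z (lo i)); rewrite ?simple_lo ?e1 ?e2 ?simple_lo // gtn_neq // ltn_lo_hi.
  rewrite (negPf nm) addn0; apply: eq_bigr => x _; congr nat_of_bool.
  have nx : simple i x != x -> z x != simple i x.
    move=> m; apply: contra c => /eqP e; apply: (@comm_moved n i z x) => //.
    by rewrite e simpleK -e zK.
  have [ex|m] := eqVneq (simple i x) x; first by rewrite ex unmoved_ltE.
  apply/idP/idP => lt; have [] := simple_lt i lt; rewrite ?simpleK //.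
    by move=> e; have := nx m; rewrite e eqxx.
  move=> e; have e' : simple i x = z x by rewrite {1}e simpleK.
  by have := nx m; rewrite e' eqxx.
have [m|nm] := boolP (merging i z); last first.
  rewrite addn0; apply: eq_bigr => x px; congr nat_of_bool.
  have [->//|mx] := eqVneq (simple i x) x.
  have lneg y : positive y -> opp (simple i x) < y.
    move=> py; have : positive (simple i x) by rewrite positive_simple.
    by rewrite -[positive _]negbK -positive_opp; move: py; rewrite /positive; lia.
  have [e|[e _]] := asc_comm sz a c mx; last by rewrite e !lneg // positive_simple.
  case/negP: nm; rewrite /merging i0 /=.
  have mlo : simple i (lo i) != lo i by rewrite simple_lo gtn_neq // ltn_lo_hi.
  have mhi : simple i (pos i) != pos i by rewrite simple_hi ltn_neq // ltn_lo_hi.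
  by rewrite (comm_fixed sz c mx mlo e) (comm_fixed sz c mx mhi e) !eqxx.
have /and3P[_ /eqP zl /eqP zh] := m.
rewrite (bigD1 (lo i)) ?positive_lo //= [in RHS](bigD1 (lo i)) ?positive_lo //=.
rewrite zl simple_lo ltn_lo_hi ltnn add0n addnC.
congr (_ + _); apply: eq_bigr => x /andP[px ne]; congr nat_of_bool.
have [->//|mx] := eqVneq (simple i x) x.
have [] := simple_moved mx => ex; move: px ne; rewrite ex ?eqxx //.
- by move=> _ _; rewrite zh simple_hi ltnn ltnNge ltnW // ltn_lo_hi.
- by rewrite positive_opp positive_lo.
- by rewrite positive_opp positive_pos.
Qed.

End Counting.

(** * Pairings that respect the signs *)

Section Compatibility.
Variable n : nat.
Implicit Types (x y : letter n) (z w f : {perm (letter n)}) (i : 'I_n) (c : skew_clan n).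

(** By skew-symmetry, equal signs at x and f x are opposite signs at x and - f x, the two ends of a
    block. *)
Definition compat c f : Prop := forall x b, c x = inr b -> c (f x) = inr b.

Lemma sign_neg c x b : c x = inr b -> clan_neg c x = opp x.
Proof. by move=> e; rewrite woppE (signP e). Qed.

(** If s does not commute with z, signs and f are relabelled together. Otherwise the moved signs of
    c form blocks {x, s x}, opposite by [step_rel], and at the unmoved signs neither c nor f
    changes. *)
Lemma compat_step i c c' w f : step_rel i c c' -> blocks (clan_neg c') w f ->
  asc i (clan_neg c') -> compat c (fstep i (clan_neg c') f) <-> compat c' f.
Proof.
move=> [_ ez h] bl a; set z' := clan_neg c' in ez bl a *.
have ez' : clan_neg c = zstep i z' by rewrite ez zstepK.
have cz : comm i (clan_neg c) = comm i z' by rewrite ez comm_zstep.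
rewrite cz in h; case: ifP h => [cm [h1 h2]|nc [h1 _]]; last first.
  have -> : fstep i z' f = wmul (simple i) (wmul f (simple i)).
    by rewrite /fstep ifF //; apply: contraFF nc; apply: merging_comm bl a.
  split=> comp x b; last by rewrite !wmulE -{1}(simpleK i x) -!h1 => /comp.
  move/h1 => e; apply/h1; have := comp _ _ e.
  by rewrite !wmulE simpleK.
have fE x b : c x = inr b -> simple i x = x ->
    fstep i z' f x = f x /\ simple i (f x) = f x.
  move=> e ex; have := sign_neg e; rewrite ez' /zstep cm wmulE ex => zx.
  rewrite /fstep; case: ifP => m; rewrite !wmulE ex.
    by split=> //; apply: (merging_unmoved bl).
  by rewrite (fstep_unmoved bl a ex cm zx).
split=> comp x b.
  move=> /h1[e ex]; have [ef sf] := fE _ _ e ex.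
  by apply/h1; rewrite -ef; split; [apply: comp|rewrite ef].
move=> e; have [ex|m] := eqVneq (simple i x) x.
  have [-> sf] := fE _ _ e ex.
  by have /h1[] : c' (f x) = inr b by apply: comp; apply/h1.
have := sign_neg e; rewrite ez' /zstep cm wmulE => zx.
have -> : fstep i z' f x = opp (simple i x).
  rewrite /fstep; case: ifP => mg; rewrite !wmulE; last exact: (fstep_moved bl a m cm zx).
  have m' : simple i (simple i x) != simple i x by rewrite simpleK eq_sym.
  have eo : simple i x = opp x by rewrite -zx (merging_fixed bl mg m').
  by have /and3P[/eqP[]] := mg; apply: simple_oppE eo.
by rewrite (sign_opp (h2 _ _ e m)) negbK.
Qed.

(** The step pairs [lo i] with [opp (pos i)], whose sign is opposite to the common one. *)
Lemma equal_signs_not_compat i c w f : equal_signs i c ->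
  blocks (zstep i (clan_neg c)) w f -> ~~ asc i (clan_neg c) ->
  ~ compat c (fstep i (zstep i (clan_neg c)) f).
Proof.
move=> [i0 [b [el eh]]] bl d; set z := clan_neg c; set z' := zstep i z.
have sz : signed z := signed_clan_neg c.
have mlo : simple i (lo i) != lo i by rewrite simple_lo gtn_neq // ltn_lo_hi.
have cm : comm i z.
  apply: (@comm_moved n i z (lo i)) => //.
  by rewrite simple_lo (sign_neg el) (sign_neg eh) simple_signed simple_lo.
have cm' : comm i z' by rewrite comm_zstep.
have a : asc i z' by rewrite asc_zstep // d.
have zl : z' (simple i (lo i)) = opp (lo i).
  by rewrite /z' /zstep cm wmulE simpleK (sign_neg el).
have nm : ~~ merging i z'.
  apply/negP => /and3P[_ _]; rewrite -simple_lo zl simple_lo => /eqP h.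
  by have := positive_pos i; rewrite -h positive_opp positive_lo.
move=> /(_ _ _ el); rewrite /fstep (negPf nm) !wmulE.
by rewrite (fstep_moved bl a mlo cm' zl) simple_lo (sign_opp eh); case: b {el eh}.
Qed.

Lemma step_rel_asc i c c' : step_rel i c c' -> asc i (clan_neg c').
Proof. by case=> d -> _; rewrite asc_zstep //; apply: signed_clan_neg. Qed.

Lemma step_rel_neq i c c' : step_rel i c c' -> c' <> c.
Proof. by move=> st e; have := step_rel_asc st; case: st => /negP d _ _; rewrite e. Qed.

Lemma step_rel_chain i c c' w f : step_rel i c c' -> chain (clan_neg c') w f ->
  chain (clan_neg c) (wmul w (simple i)) (fstep i (clan_neg c') f).
Proof.
move=> st ch; have a := step_rel_asc st; case: st => _ e _.
rewrite -(zstepK i (clan_neg c)) -e; exact: chain_cons.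
Qed.

(** The doubling condition says that z exchanges i and i + 1; undoing the step turns this 2-cycle
    into two fixed points. *)
Lemma clan_doubled_merging i c c' : step_rel i c c' ->
  clan_doubled i c = merging i (clan_neg c').
Proof.
move=> st; have a := step_rel_asc st; case: st => _ e _.
have ez : clan_neg c = zstep i (clan_neg c') by rewrite e zstepK.
rewrite /clan_doubled /merging; have [//|i0] := eqVneq (i : nat) 0.
have lE : pos (ord_pred i) = lo i by rewrite /lo (negPf i0).
rewrite /neg !lE /=.
have inlE x y : y != opp x -> (c (opp x) == inl y) = (clan_neg c x == y).
  move=> ne; rewrite woppE -signed_clan_iota clan_iotaE.
  by case: (c (opp x)) => // b; rewrite [opp x == y]eq_sym (negPf ne).
have neo x y : positive x -> positive y -> y != opp x.
  by move=> px py; apply: contraTneq py => ->; rewrite positive_opp px.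
have plo := positive_lo i0; have phi := positive_pos i.
rewrite !inlE ?neo //.
have mlo : simple i (lo i) != lo i by rewrite simple_lo gtn_neq // ltn_lo_hi.
apply/andP/andP => -[/eqP h1 /eqP h2].
  have cm : comm i (clan_neg c).
    apply: (comm_moved (signed_clan_neg c) mlo).
    by rewrite simple_lo h1 h2 simple_hi.
  by rewrite e /zstep cm !(wmulE (clan_neg c)) simple_lo simple_hi h1 h2 !eqxx.
have cm : comm i (clan_neg c').
  apply: (comm_moved (signed_clan_neg c') mlo).
  by rewrite simple_lo h1 h2 simple_lo.
by rewrite ez /zstep cm !(wmulE (clan_neg c')) simple_lo simple_hi h1 h2 !eqxx.
Qed.

End Compatibility.

(** * Alternating clans *)

Section Alternation.
Variable n : nat.
Implicit Types (x y p q : letter n) (z w f : {perm (letter n)}) (i : 'I_n) (c : skew_clan n).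

Lemma sorted_adjacent (r : rel (letter n)) (s : seq (letter n)) :
  sorted (fun x y => x < y) s ->
  sorted r s <-> forall p q, p \in s -> q \in s -> p < q ->
    (forall x, x \in s -> ~~ (p < x < q)) -> r p q.
Proof.
case: s => [|x0 s0]; first by [].
set s := x0 :: s0 => ss; have tr : transitive (fun x y : letter n => x < y).
  by move=> y x t; apply: ltn_trans.
have mono k l : k < l -> l < size s -> nth x0 s k < nth x0 s l.
  move=> kl ls; apply: (sorted_ltn_nth tr x0 ss) => //; rewrite inE //.
  exact: ltn_trans ls.
have mono' k l : k < size s -> nth x0 s k < nth x0 s l -> k < l.
  move=> ks; rewrite ltnNge; apply: contraNltn; rewrite leq_eqVlt => /orP[/eqP->//|lt].
  by rewrite ltnW // mono.
split.
  move=> /(sortedP x0) al p q /(nthP x0)[k ks <-] /(nthP x0)[l ls <-] lt none.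
  have kl := mono' _ _ ks lt; have [e|ne] := eqVneq l k.+1; first by rewrite e; apply: al; rewrite -e.
  have k1 : k.+1 < l by rewrite ltn_neqAle eq_sym ne.
  have k1s := ltn_trans k1 ls.
  by have := none _ (mem_nth x0 k1s); rewrite !mono.
move=> al; apply/(sortedP x0) => k ks; have ks' := ltnW ks.
apply: al; rewrite ?mem_nth ?mono // => x /(nthP x0)[l ls <-].
apply/negP => /andP[/(mono' _ _ ks') h1 /(mono' _ _ ls)]; rewrite ltnS leqNgt h1 //.
Qed.

(* Entries other than signs are immaterial, which makes the deletion of two
   adjacent signs below easy to express. *)
Definition alternates (g : letter n -> option bool) : Prop :=
  forall p q a b, g p = Some a -> g q = Some b -> p < q ->
    (forall x, p < x -> x < q -> g x = None) -> a != b.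

Definition sign_at c x : option bool := if c x is inr b then Some b else None.

Lemma sign_atP c x b : sign_at c x = Some b <-> c x = inr b.
Proof. by rewrite /sign_at; case: (c x) => // b'; split=> -[->]. Qed.

Lemma alternatingP c : alternating c <-> alternates (sign_at c).
Proof.
rewrite /alternating signsE; set F := filter _ _.
have sF : sorted (fun x y => x < y) F.
  by apply: sorted_filter (enum_letter_sorted n) => y x t; apply: ltn_trans.
have memF x : (x \in F) = is_sign (c x) by rewrite mem_filter mem_enum andbT.
rewrite sorted_map (sorted_adjacent _ sF); split=> al p q.
  move=> a b /sign_atP ep /sign_atP eq lt none.
  have := al p q; rewrite !memF /= /sgn_of ep eq; apply=> // x.
  rewrite memF; case E: (c x) => [//|b'] _; apply/negP => /andP[h1 h2].
  by have := none x h1 h2; rewrite /sign_at E.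
rewrite !memF /= /sgn_of; case ep: (c p) => [//|a] _; case eq: (c q) => [//|b] _ lt none.
apply: (al p q); rewrite ?(iffRL (sign_atP _ _ _) ep) ?(iffRL (sign_atP _ _ _) eq) //.
move=> x h1 h2; rewrite /sign_at; case E: (c x) => [//|b'].
by have := none x; rewrite memF E h1 h2 => /(_ isT).
Qed.

Lemma alternates_eq (g h : letter n -> option bool) : g =1 h -> alternates g -> alternates h.
Proof.
move=> e al p q a b; rewrite -!e => ep eq lt none; apply: (al p q) => // x h1 h2.
by rewrite e none.
Qed.

Definition delete_pair (g : letter n -> option bool) (u v x : letter n) : option bool :=
  if (x == u) || (x == v) then None else g x.

(** The nearest signs on the two sides of the deleted pair differ from a and from its negation
    respectively, hence from each other. *)
Lemma alternates_delete g (u v : letter n) a :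
  v = u.+1 :> nat -> g u = Some a -> g v = Some (~~ a) ->
  alternates g -> alternates (delete_pair g u v).
Proof.
move=> vu eu ev al p q bp bq; rewrite /delete_pair.
case: ifP => // /norP[pu pv] ep; case: ifP => // /norP[qu qv] eq lt none.
rewrite -letter_eqE in pu; rewrite -letter_eqE in pv.
rewrite -letter_eqE in qu; rewrite -letter_eqE in qv.
have none' x : p < x -> x < q -> x != u -> x != v -> g x = None.
  by move=> h1 h2 h3 h4; have := none x h1 h2; rewrite (negPf h3) (negPf h4).
have [pu'|pu'] := ltnP p u; have [uq|uq] := ltnP u q.
- have vq : v < q by clear - vu uq qv; lia.
  have h1 : bp != a.
    apply: (al p u) => // x h1 h2; apply: none' => //; first exact: ltn_trans uq.
      exact: ltn_neq.
    by apply: ltn_neq; clear - vu h2; lia.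
  have h2 : ~~ a != bq.
    apply: (al v q) => // x h2 h3; apply: none' => //.
      by clear - vu pu' h2; lia.
      by apply: gtn_neq; clear - vu h2; lia.
    exact: gtn_neq.
  by case: bp a bq h1 h2 {ep eq eu ev} => [] [] [].
- apply: (al p q) => // x h1 h2; apply: none' => //; apply: ltn_neq; clear - uq h2 vu; lia.
- apply: (al p q) => // x h1 h2; apply: none' => //; apply: gtn_neq; clear - pu pu' pv h1 vu; lia.
- apply: (al p q) => // x h1 h2; apply: none' => //; apply: gtn_neq; clear - pu pu' pv h1 vu; lia.
Qed.

(** A commuting step that meets signs deletes the opposite neighbours at [lo i], [pos i] and, for i
    > 0, their mirror image; any other step keeps the sequence of signs. *)
Lemma alternates_step i c c' : step_rel i c c' -> alternating c -> alternating c'.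
Proof.
case=> d _; case: ifP => cm [h1 h2]; last by rewrite /alternating h2.
rewrite !alternatingP => al; have sz := signed_clan_neg c.
have mlo : simple i (lo i) != lo i by rewrite simple_lo gtn_neq // ltn_lo_hi.
have mhi : simple i (pos i) != pos i by rewrite simple_hi ltn_neq // ltn_lo_hi.
have e x : sign_at c' x = if simple i x == x then sign_at c x else None.
  have [ex|m] := eqVneq (simple i x) x; rewrite /sign_at.
    case E: (c x) => [t|b]; last by rewrite (iffRL (h1 x b)).
    by case E': (c' x) => [//|b]; have [] := iffLR (h1 x b) E'; rewrite E.
  by case E': (c' x) => [//|b]; have [_ e] := iffLR (h1 x b) E'; rewrite e eqxx in m.
case El: (c (lo i)) => [t|b].
  have none x : simple i x != x -> sign_at c x = None.
    move=> m; rewrite /sign_at; case E: (c x) => [//|b].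
    have := comm_fixed (signed_clan_iota c) _ m mlo (signP E).
    rewrite -comm_wopp cm => /(_ isT)/sign_ex[b']; by rewrite El.
  by apply: alternates_eq al => x; rewrite e; case: ifP => // /negbT/none.
have Eh := h2 _ _ El mlo; rewrite simple_lo in Eh.
have al1 : alternates (delete_pair (sign_at c) (lo i) (pos i)).
  by apply: (alternates_delete (hi_lo i) _ _ al); apply/sign_atP; eassumption.
have [i0|i0] := eqVneq (i : nat) 0.
  apply: alternates_eq al1 => x; rewrite e /delete_pair.
  have plo : lo i = opp (pos i) by rewrite -opp_lo0 // oppK.
  have [ex|m] := eqVneq (simple i x) x.
    rewrite ifF //; apply/negP => /orP[] /eqP h; move: mlo mhi; rewrite -h ex ?eqxx //.
  rewrite ifT //; have [] := simple_moved m => ->; rewrite ?eqxx ?orbT // ?plo ?oppK ?eqxx ?orbT //.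
have hl : opp (lo i) = (opp (pos i)).+1 :> nat.
  by rewrite !oppE; have := hi_lo i; have := ltn_ord (pos i); clear; lia.
have ne x y : positive x -> positive y -> (opp x == y) = false.
  by move=> px py; apply/eqP => ee; move: py; rewrite -ee positive_opp px.
have plo := positive_lo i0; have phi := positive_pos i.
have := alternates_delete (a := b) hl _ _ al1.
rewrite {1 2}/delete_pair !ne //= => /(_ _ _)al2.
have {}al2 : alternates
    (delete_pair (delete_pair (sign_at c) (lo i) (pos i)) (opp (pos i)) (opp (lo i))).
  by apply: al2; apply/sign_atP; rewrite ?(sign_opp El) ?(sign_opp Eh) ?negbK.
apply: alternates_eq al2 => x; rewrite e /delete_pair.
have [ex|m] := eqVneq (simple i x) x.
  have nx t : simple i t != t -> (x == t) = false.
    by move=> mt; apply/eqP => h; move: mt; rewrite -h ex eqxx.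
  by rewrite !nx ?simple_opp_moved.
by have [] := simple_moved m => ->; rewrite ?eqxx ?orbT //; case: ifP.
Qed.

Lemma descent_between z p q : p < q -> z q < z p ->
  exists x y, [/\ y = x.+1 :> nat, p <= x, y <= q & z y < z x].
Proof.
move: {2}(q - p) (erefl (q - p)) => m; elim: m p => [|m IH] p e lt ltz.
  by move: e lt; clear; lia.
have lt1 : p.+1 < n + n by apply: leq_ltn_trans (ltn_ord q).
pose p1 : letter n := Ordinal lt1.
have [h|h] := ltnP (z p1) (z p); first by exists p, p1.
have ne : p1 != q by apply: contraTneq ltz => <-; rewrite -leqNgt.
have lt1q : p1 < q by move: ne; rewrite -letter_eqE /=; move: lt; clear; lia.
have [|x [y [h1 h2 h3 h4]]] := IH p1 _ lt1q (leq_trans ltz h); first by move: e; rewrite /=; clear; lia.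
by exists x, y; split=> //; apply: ltnW.
Qed.

(** z sends p < q to - p > - q, so it descends at some two neighbours within [p, q]. *)
Lemma sign_descent c p q b b' : c p = inr b -> c q = inr b' -> p < q ->
  exists i x, [/\ x < simple i x, p <= x, simple i x <= q & ~~ asc i (clan_neg c)].
Proof.
move=> ep eq lt; have [|x [y [e h1 h2 h3]]] := @descent_between (clan_neg c) p q lt.
  by rewrite (sign_neg ep) (sign_neg eq) ltn_opp.
have [i ey] := simple_ex e; exists i, x; rewrite ey; split=> //; first by rewrite e.
apply: contraL h3 => a; rewrite -leqNgt -ey ltnW //.
by apply: asc_lt => //; [exact: signed_clan_neg|rewrite ey e].
Qed.

Variable dem : {perm (letter n)} -> {perm (letter n)} -> {perm (letter n)}.
Hypothesis dd : is_demazure dem.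

Lemma moved_signs i c x b : comm i (clan_neg c) -> simple i x != x -> c x = inr b ->
  forall t, simple i t != t -> exists b', c t = inr b'.
Proof.
move=> cm m e t mt; apply: sign_ex.
by apply: (comm_fixed (signed_clan_iota c) _ m mt (signP e)); rewrite -comm_wopp.
Qed.

Lemma equal_signs_comm i c : equal_signs i c -> comm i (clan_neg c).
Proof.
case=> _ [b [el eh]]; apply: (@comm_moved n i _ (lo i)); first exact: signed_clan_neg.
  by rewrite simple_lo gtn_neq // ltn_lo_hi.
by rewrite simple_lo (sign_neg el) (sign_neg eh) simple_signed simple_lo.
Qed.

(* Two consecutive equal signs can be brought next to each other and then
   matched. *)
Lemma not_alternating_ex c : ~ alternating c ->
  exists w f, chain (clan_neg c) w f /\ ~ compat c f.
Proof.
have [m] := ubnP (inv2 (clan_neg c)); elim: m c => // m IH c ltm na.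
have [p [q [a [ep eq lt none]]]] : exists p q a, [/\ c p = inr a, c q = inr a, p < q &
    forall x, p < x -> x < q -> sign_at c x = None].
  apply: contrapT => h; apply: na; apply/alternatingP => p q a b.
  move=> /sign_atP ep /sign_atP eq lt none; apply/negP => /eqP e.
  by apply: h; exists p, q, a; rewrite {2}e.
have [i [x [ltx px qx d]]] := sign_descent ep eq lt.
have mx : simple i x != x by apply: gtn_neq.
have sz := signed_clan_neg c; have zK := @clan_negK n c.
have [c' [_ [st|[_ [a'|es]]]]] := clan_step dd i c; last first.
- have [w [f ch]] := chain_ex (signed_zstep i sz) (involutive_zstep i zK).
  exists (wmul w (simple i)), (fstep i (zstep i (clan_neg c)) f); split.
    exact: chain_step.
  by apply: equal_signs_not_compat => //; apply: chain_blocks ch.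
- by rewrite a' in d.
have lt' : inv2 (clan_neg c') < m.
  by case: st => _ -> _; have := inv2_zstep_desc sz zK d; move: ltm; clear; lia.
(* In the commuting case x and s x lie in [p, q]. If they carried signs they would be p and q, whose
   signs agree, while the step needs opposite ones; so no sign is lost. *)
have na' : ~ alternating c'.
  case: st => _ _; case: ifP => cm [h1 h2]; last by rewrite /alternating h2.
  have nsg t : simple i t != t -> sign_at c t = None.
    move=> mt; rewrite /sign_at; case E: (c t) => [//|b].
    have sg := moved_signs cm mt E.
    have [b1 e1] := sg _ mx; have [|b2 e2] := sg (simple i x); first by rewrite simpleK eq_sym.
    have ex : x = p.
      apply/eqP/negPn/negP => ne; have := none x.
      rewrite ltn_neqAle px andbT eq_sym letter_eqE ne (leq_trans ltx qx) /sign_at e1.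
      by move=> /(_ isT isT).
    have ey : simple i x = q.
      apply/eqP/negPn/negP => ne; have := none (simple i x).
      rewrite (leq_ltn_trans px ltx) ltn_neqAle qx andbT letter_eqE ne /sign_at e2.
      by move=> /(_ isT isT).
    by have := h2 x a; rewrite mx {1}ex ep ey eq => /(_ erefl isT)[]; case: (a).
  rewrite alternatingP => al; apply/na/alternatingP; apply: alternates_eq al => t.
  rewrite /sign_at; case E: (c t) => [u|b].
    by case E': (c' t) => [//|b]; have [] := iffLR (h1 t b) E'; rewrite E.
  rewrite (iffRL (h1 t b)) //; split=> //; apply/eqP/negPn/negP => /nsg.
  by rewrite /sign_at E.
have [w [f [ch nc]]] := IH c' lt' na'.
have ch' := step_rel_chain st ch.
exists (wmul w (simple i)), (fstep i (clan_neg c') f); split=> // /(compat_step st (chain_blocks ch)).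
by move=> /(_ (step_rel_asc st)).
Qed.

(** Alternation excludes equal neighbouring signs and is inherited by t_i . c, so every step of the
    chain is an edge. *)
Lemma alternating_compat z w f : chain z w f ->
  forall c, clan_neg c = z -> alternating c -> compat c f.
Proof.
elim=> [|i z' w' f' ch IH a] c ez al.
  by move=> x b e; have := sign_neg e; rewrite ez perm1 => /eqP; rewrite eq_sym (negPf (opp_neq x)).
have sz' := blocks_z (chain_blocks ch).
have d : ~~ asc i (clan_neg c) by rewrite ez asc_zstep // a.
have [c' [_ [st|[_ [a'|es]]]]] := clan_step dd i c.
- have ez' : clan_neg c' = z' by case: st => _ -> _; rewrite ez zstepK.
  have := compat_step st; rewrite ez' => /(_ _ _ (chain_blocks ch) a) h; apply/h.
  by apply: IH => //; apply: alternates_step st al.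
- by rewrite a' in d.
case: es => i0 [b [/sign_atP el /sign_atP eh]].
move/alternatingP: al => /(_ _ _ _ _ el eh (ltn_lo_hi i)).
rewrite eqxx => h; suff: false by []; apply: h => x.
by rewrite hi_lo ltnS ltnNge => /negPf->.
Qed.

(** With signs present, let p be the least positive position of a sign. A descent within [- p, p]
    fails to be an edge only if all its moved letters carry signs and i > 0; as no sign lies
    strictly between - p and p, the moved neighbours would be - p and p, which forces t_0. *)
Lemma clan_step_ex c : clan_neg c <> 1%g ->
  exists i c', clan_act dem i c c' /\ step_rel i c c'.
Proof.
move=> ne1; have [h|] := boolP [exists x, is_sign (c x)]; last first.
  move=> /existsPn ns; have [i d] := desc_ex (signed_clan_neg c) ne1.
  have [c' [ac [st|[_ [a|[_ [b [e _]]]]]]]] := clan_step dd i c.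
  - by exists i, c'.
  - by rewrite a in d.
  - by have := ns (lo i); rewrite e.
have [x0 /andP[sg0 pos0]] : exists x, is_sign (c x) && positive x.
  move/existsP: h => [x sg]; have [px|nx] := boolP (positive x); first by exists x; rewrite sg.
  by exists (opp x); rewrite positive_opp nx entry_skew; case: (c x) sg.
have := @arg_minnP _ x0 (fun x => is_sign (c x) && positive x) val.
rewrite sg0 pos0 => /(_ isT)[p /andP[sgp pp] min].
have [b e] : exists b, c p = inr b by case: (c p) sgp => // b _; exists b.
have lt : opp p < p by rewrite -positiveE.
have [i [x [ltx px qx d]]] := sign_descent (sign_opp e) e lt.
have mx : simple i x != x by apply: gtn_neq.
have [c' [ac [st|[_ [a|es]]]]] := clan_step dd i c.
- by exists i, c'.
- by rewrite a in d.
have mlo : simple i (lo i) != lo i by rewrite simple_lo gtn_neq // ltn_lo_hi.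
have cm := equal_signs_comm es; case: (es) => i0 [b' [el _]].
have sg := moved_signs cm mlo el.
have [b1 e1] := sg _ mx; have [|b2 e2] := sg (simple i x); first by rewrite simpleK eq_sym.
have far t b'' : c t = inr b'' -> positive t -> p <= t.
  by move=> et pt; apply: min; rewrite et pt.
case/negP: i0; apply/eqP; apply: (@simple_oppE n i x).
have crs : positive x != positive (simple i x).
  have pxx : positive x -> p <= x by apply: far e1.
  have nsx : ~~ positive (simple i x) -> simple i x <= opp p.
    move=> ns; have := far _ _ (sign_opp e2); rewrite positive_opp ns => /(_ isT).
    by rewrite leqNgt -ltn_opp oppK -leqNgt.
  apply/negP => /eqP ps; case px' : (positive x) ps => ps.
    by have := leq_trans (leq_ltn_trans (pxx px') ltx) qx; rewrite ltnn.
  have := nsx; rewrite -ps => /(_ isT) => h2.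
  by have := leq_ltn_trans px (leq_trans ltx h2); rewrite ltnn.
exact: simple_cross.
Qed.

End Alternation.

(** * Shapes as noncrossing symmetric perfect matchings *)

Section ShapesAndClans.
Variable n : nat.
Implicit Types (x y : letter n) (w f : {perm (letter n)}) (c : skew_clan n).

Section Blocks.
Variables (c : skew_clan n) (w f : {perm (letter n)}).
Hypothesis bl : blocks (clan_neg c) w f.
Let z := clan_neg c.
Let M := sh w^-1%g.
Let sf := blocks_f bl.
Let fK := blocks_fK bl.

Lemma shape_block_neq x : opp (f x) != x.
Proof.
rewrite (inv_eq (@oppK n)); have [px|nx] := boolP (positive (w x)).
  exact: (blocks_neq_opp bl).
have := @blocks_neq_opp _ _ _ _ bl (opp x).
by rewrite (word_opp bl) nx sf (inj_eq (@opp_inj n)) => /(_ isT).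
Qed.

Lemma mem_sh_block A x : A \in M -> x \in A -> A = shape_block f x /\ z x = opp x.
Proof.
move=> /(mem_sh bl)[u [eu ->]]; rewrite !inE => /orP[]/eqP->; first by [].
rewrite (shape_block_opp bl); split=> //.
by rewrite (blocks_z bl) (blocks_neg bl eu).
Qed.

Lemma mem_sh2 x y : [set x; y]%SET \in M -> z x = opp x /\ y = opp (f x).
Proof.
move=> h; have [] := mem_sh_block h (finset.set21 x y) => e ex; split=> //.
have : opp (f x) \in [set x; y]%SET by rewrite e finset.set22.
by rewrite !inE (negPf (shape_block_neq x)) => /eqP.
Qed.

Lemma sh_perfect : perfect_matching [set x | is_sign (c x)]%SET M.
Proof.
apply/andP; split; last first.
  apply/forall_inP => A /(mem_sh bl)[u [_ ->]].
  by rewrite finset.cards2 [u == _]eq_sym shape_block_neq.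
apply/and3P; split.
- apply/eqP/finset.setP => x; rewrite inE is_sign_neg; apply/finset.bigcupP/eqP.
    by move=> [A AM /(mem_sh_block AM)[]].
  move=> ex; exists (shape_block f x); last exact: finset.set21.
  by apply/(mem_sh bl); exists x.
- apply/finset.trivIsetP => A B AM BM; apply: contraNT.
  move=> /pred0Pn[x /andP[xA xB]].
  by have [-> _] := mem_sh_block AM xA; have [-> _] := mem_sh_block BM xB.
- apply/negP => /(mem_sh bl)[u [_ e]].
  by have := finset.in_set0 u; rewrite e finset.set21.
Qed.

Lemma sh_symmetric : symmetric_matching M.
Proof.
apply/forall_inP => A /(mem_sh bl)[u [eu ->]]; apply/(mem_sh bl); exists (opp u).
split; first by rewrite (blocks_z bl) eu.
by rewrite /shape_block finset.imsetU !finset.imset_set1 sf.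
Qed.

Lemma sh_noncrossing : noncrossing M.
Proof.
move=> i j k l ij jk kl [/mem_sh2[ei ek] /mem_sh2[ej el]].
by apply: (blocks_noncrossing bl ei ej ij); rewrite -?ek // -el.
Qed.

(** Only the sign condition is at stake, the other three hold for every atom. The left side does not
    mention f, so [compat] takes the same value for all f attached to w. *)
Lemma sh_NCSP : NCSP_CI c M <-> compat c f.
Proof.
split=> [[_ _ _ h] x b e|comp].
  have [|b' []] := h x (opp (f x)).
    by apply/(mem_sh bl); exists x; split=> //; apply: sign_neg e.
  rewrite e => -[<-] /sign_opp; by rewrite oppK negbK.
split; [exact: sh_perfect|exact: sh_symmetric|exact: sh_noncrossing|].
move=> x y /mem_sh2[/eqP ex ->]; rewrite -is_sign_neg in ex.
case e: (c x) ex => [//|b] _; exists b; split=> //.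
exact: sign_opp (comp _ _ e).
Qed.

End Blocks.
End ShapesAndClans.

(** * Paths of orbits *)

Section Orbits.
Variables (R : realType) (n : nat).
Variable dem : {perm (letter n)} -> {perm (letter n)} -> {perm (letter n)}.
Hypothesis dd : is_demazure dem.
Variable orb : skew_clan n -> set (set (mat R n)).
Hypothesis param : clan_parametrization dem orb.
Implicit Types (i : 'I_n) (c : skew_clan n) (w f z : {perm (letter n)}).

Lemma orbit_act_fun i c c' O : clan_act dem i c c' -> orbit_act i (orb c) O -> O = orb c'.
Proof. by move=> /(orb_act param)[ac _] [_ u]; apply: u. Qed.

(* A dense orbit is the dense orbit of every set between itself and G / B, so
   it is fixed by all t_i. *)
Lemma dense_clan_neg c : dense_orbit_in (quot (@B R n)) (orb c) -> clan_neg c = 1%g.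
Proof.
move=> [o sub dense]; apply: contrapT => /(clan_step_ex dd)[i [c' [ac st]]].
apply: (step_rel_neq st); apply: (orb_inj param).
have [_ u] := orb_act param ac; apply: u; split=> //.
  by move=> F Fo; split; [exact: sub|exists F].
by move=> F [Fq _]; apply: dense.
Qed.

Lemma ell0_1 : ell0 (1 : {perm (letter n)}) = 0.
Proof. by rewrite ell0E big1 // => x; rewrite perm1 negativeE => ->. Qed.

Lemma drops1 : drops (1 : {perm (letter n)}) = 0.
Proof. by rewrite dropsE big1 // => x _; rewrite perm1 ltnn. Qed.

Lemma path_chain P c : path_to_dense (orb c) P -> exists f,
  [/\ chain (clan_neg c) (path_elt P) f, compat c f &
      path_doubled (orb c) P + ell0 (path_elt P) = drops (clan_neg c)].
Proof.
elim: P c => [|[i O] P IH] c /=.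
  move=> /dense_clan_neg e; exists 1%g; rewrite e ell0_1 drops1; split=> //.
    exact: chain_nil.
  by move=> x b; rewrite perm1.
move=> [ac ne]; have [c' [cac]] := clan_step dd i c.
have eO := orbit_act_fun cac ac; subst O.
case=> [st|[e _]]; last by case: ne; rewrite e.
move=> /IH[f [ch comp e]]; have bl := chain_blocks ch; have a := step_rel_asc st.
exists (fstep i (clan_neg c') f); split; first exact: step_rel_chain st ch.
  exact/(compat_step st bl a).
have -> : `[< doubled i (orb c) >] = merging i (clan_neg c').
  rewrite -(clan_doubled_merging st).
  by apply/asboolP/idP => /(orb_doubled param cac (step_rel_neq st)).
rewrite ell0_asc; [|exact: blocks_w bl|]; last first.
  by have := @asc_word n i _ _ _ bl a (lo i); rewrite simple_lo; apply; apply: ltn_lo_hi.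
have -> : clan_neg c = zstep i (clan_neg c') by case: st => _ -> _; rewrite zstepK.
rewrite drops_zstep //; [|exact: blocks_z bl|exact: blocks_zK bl].
(* A merging has i > 0, so the disjunction in [drops_zstep] is a sum: one term goes to d(P), the
   other to [ell0]. *)
have mi : merging i (clan_neg c') && (i == 0 :> nat) = false.
  by rewrite /merging; case: (eqVneq (i : nat) 0) => _; rewrite ?andbF.
by rewrite -e; case: merging mi; case: (_ == _) => //= _; clear; lia.
Qed.

Lemma dense_path c : clan_neg c = 1%g -> dense_orbit_in (quot (@B R n)) (orb c).
Proof.
move=> e; apply: (orb_dense param) => x.
have ex : clan_iota c x = opp x by apply: opp_inj; rewrite -woppE -/(clan_neg c) e perm1 oppK.
move: ex; rewrite clan_iotaE; case: (c x) => [y ->//|b /eqP].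
by rewrite eq_sym (negPf (opp_neq x)).
Qed.

(** Each step is a descent of - iota(c), so only equal signs could keep it from being an edge, and
    [compat] rules them out. *)
Lemma chain_path z w f : chain z w f -> forall c, clan_neg c = z -> compat c f ->
  exists2 P, path_to_dense (orb c) P & path_elt P = w.
Proof.
elim=> [|i z' w' f' ch IH a] c ez comp; first by exists [::] => //; apply: dense_path.
have bl := chain_blocks ch; have sz' := blocks_z bl.
have d : ~~ asc i (clan_neg c) by rewrite ez asc_zstep // a.
have [c' [cac [st|[_ [a'|es]]]]] := clan_step dd i c.
- have ez' : clan_neg c' = z' by case: st => _ -> _; rewrite ez zstepK.
  have := compat_step st; rewrite ez' => /(_ _ _ bl a) h.
  have [P pP eP] := IH c' ez' (iffLR h comp).
  exists ((i, orb c') :: P) => /=; last by rewrite eP.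
  split=> //; first exact: (orb_act param cac).
  by move/(orb_inj param); apply: step_rel_neq st.
- by rewrite a' in d.
have e' : zstep i (clan_neg c) = z' by rewrite ez zstepK.
have := @equal_signs_not_compat _ i c w' f' es; rewrite e'.
by move=> /(_ bl d).
Qed.

Lemma brion_atomsP c w : brion_atoms (orb c) w <->
  exists f, chain (clan_neg c) w f /\ compat c f.
Proof.
split=> [[P /path_chain[f [ch comp _]] <-]|[f [ch comp]]]; first by exists f.
by have [P pP eP] := chain_path ch erefl comp; exists P.
Qed.

End Orbits.

Local Open Scope ring_scope.
Local Open Scope classical_set_scope.

Theorem theorem8p2 (R : realType) (n : nat) (n_ge1 : (1 <= n)%N)
  (dem : {perm (letter n)} -> {perm (letter n)} -> {perm (letter n)})
  (dem_demazure : is_demazure dem)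
  (orb : skew_clan n -> set (set (mat R n)))
  (orb_param : clan_parametrization dem orb)
  (gamma : skew_clan n) :
  let O := orb gamma in
  let z := wopp (clan_iota gamma) in
  [/\ forall (w : {perm (letter n)}) P, path_to_dense O P -> path_elt P = w ->
        (path_doubled O P)%:Z =
          #|[pred i : letter n | positive i && (z i < i)%N]|%:Z - (ell0 w)%:Z,
      brion_atoms O = \bigcup_(M in NCSP_CI gamma) atoms_sh dem z M,
      trivIset (NCSP_CI gamma) (atoms_sh dem z),
      brion_atoms O `<=` atoms dem z &
      brion_atoms O = atoms dem z <-> alternating gamma].
Proof.
move=> O z; have atomE w : atoms dem z w <-> exists f, chain z w f.
  exact: atomsP dem_demazure z w.
have brionE w : brion_atoms O w <-> exists f, chain z w f /\ compat gamma f.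
  exact (brion_atomsP dem_demazure orb_param gamma w).
have sub : brion_atoms O `<=` atoms dem z.
  by move=> w /brionE[f [ch _]]; apply/atomE; exists f.
split=> //.
- move=> w P /(path_chain dem_demazure orb_param)[f [_ _ e]] <-.
  by rewrite -[#|_|]/(drops z) -e PoszD GRing.addrK.
- apply/seteqP; split=> w.
    move=> /brionE[f [ch comp]]; exists (sh w^-1%g).
      exact/(sh_NCSP (chain_blocks ch)).
    by split=> //; apply/atomE; exists f.
  move=> [M MN [/atomE[f ch] e]]; apply/brionE; exists f; split=> //.
  by apply/(sh_NCSP (chain_blocks ch)); rewrite e.
- by move=> M N _ _ [w [[_ <-] [_ <-]]].
- split=> [e|al].
    apply: contrapT => /(not_alternating_ex dem_demazure)[w [f [ch nc]]].
    have : brion_atoms O w by rewrite e; apply/atomE; exists f.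
    move=> /brionE[f' [ch' comp']]; apply: nc.
    (* [f] and [f'] belong to the same [w]: compatibility passes from one to the other through the
       shape. *)
    apply/(sh_NCSP (chain_blocks ch)).
    exact/(sh_NCSP (chain_blocks ch')).
  apply/seteqP; split=> // w /atomE[f ch]; apply/brionE; exists f; split=> //.
  exact (alternating_compat dem_demazure ch erefl al).
Qed.
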